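(* Let $r\ge2$ and $s>r$. Let $H$ be an $(s,s-r)$-starplus on $k$ vertices (with $k>s$) with $\lambda_1\ge2$ rays and excess $\lambda_2\ge 0$ such that $$\frac{\lambda_1+\lambda_2}{\lambda_1-1}\le\frac{k-s+r}{k-s}$$ and whose flower $H_1$ is edge-balanced. Then there is a strategy $\mathcal S$ such that for every $t=t(n)\gg n^{\,r-\frac{k-s+r}{\lambda_1+\lambda_2}}$, a.a.s. $G^{(r,s)}_t$ contains a copy of $H$. Consequently (together with the general lower bound) $\tau^{(r)}(H)=n^{\,r-\frac{k-s+r}{\lambda_1+\lambda_2}}$.
   Context: Semi-random hypergraph process: fix integers $1\le r<s$ and $n\ge s$. Start with the empty $s$-uniform multi-hypergraph $G_0^{(r,s)}$ on $[n]$. In each step $t\ge1$, a set $U_t$ of $r$ vertices is chosen uniformly at random among all $r$-subsets of $[n]$, independently of all previous choices; the player chooses an $(s-r)$-set $V_t\subseteq[n]\setminus U_t$, and the edge $U_t\cup V_t$ is added to form $G^{(r,s)}_t$ (parallel edges allowed). A strategy is, for each $n$, a sequence of functions determining $V_t$ from $(U_1,V_1,\dots,U_{t-1},V_{t-1},U_t)$. A.a.s. means with probability $\to1$ as $n\to\infty$; $a_n\gg b_n$ means $b_n=o(a_n)$. ''$\tau^{(r)}(H)\le f$'': some strategy gives, for every $t\gg f$, a.a.s. a copy of $H$ in $G_t^{(r,s)}$; ''$\tau^{(r)}(H)\ge f$'': for every strategy and $t=o(f)$, a.a.s. no copy; ''$=$'' means both. Starplus: for integers $1\le c<s$, an $(s,c)$-starplus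 with $\lambda_1$ rays and excess $\lambda_2$ is an $s$-uniform hypergraph $H$ on a vertex set $V$ with a distinguished set $C\subseteq V$, $|C|=c$ (the center), such that exactly $\lambda_1$ edges contain $C$, these $\lambda_1$ edges together cover all of $V$, and the remaining $\lambda_2$ edges (the cap) do not contain $C$ (they may intersect $C$). The flower of $H$ is the $(s-c)$-uniform hypergraph $H_1$ on vertex set $V\setminus C$ with edge set $\{e\setminus C: C\subseteq e\in E(H)\}$. Density and edge-balancedness: for an $r$-uniform hypergraph $F$ with $v_F$ vertices and $e_F\ge1$ edges, $g(F)=1/r$ if $e_F=1$ and $g(F)=\frac{e_F-1}{v_F-r}$ if $e_F>1$. $F$ is edge-balanced if every sub-hypergraph $F'\subseteq F$ with $e_{F'}>0$ satisfies $g(F')\le g(F)$. *)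

(* Defs.v *)
From mathcomp Require Import all_boot.
From Stdlib Require Import Reals.
Set Implicit Arguments. Unset Strict Implicit. Unset Printing Implicit Defensive.

(* A (deterministic) strategy: for each n, a function mapping the history
   [(U_1,V_1);...;(U_{t-1},V_{t-1})] (chronological order) and the new random
   r-set U_t to the chosen set V_t. *)
Definition strategy : Type :=
  forall n : nat, seq ({set 'I_n} * {set 'I_n}) -> {set 'I_n} -> {set 'I_n}.

(* V_t must be an (s-r)-subset of [n] \ U_t (the process is defined for n >= s). *)
Definition valid_strategy (r s : nat) (S : strategy) : Prop :=
  forall n : nat, (s <= n)%N ->
  forall (hist : seq ({set 'I_n} * {set 'I_n})) (U : {set 'I_n}),
    #|U| = r -> (S n hist U \subset ~: U) /\ #|S n hist U| = (s - r)%N.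

Fixpoint run_hist (n : nat) (S : strategy) (hist : seq ({set 'I_n} * {set 'I_n}))
    (us : seq {set 'I_n}) : seq ({set 'I_n} * {set 'I_n}) :=
  match us with
  | [::] => hist
  | U :: us' => run_hist S (rcons hist (U, S n hist U)) us'
  end.

Definition process_edges (n : nat) (S : strategy) (us : seq {set 'I_n}) : seq {set 'I_n} :=
  [seq p.1 :|: p.2 | p <- run_hist S [::] us].

(* G (a multi-hypergraph on [n], given by its list of edges) contains a copy of
   the hypergraph H = ('I_k, E). *)
Definition has_copy (k : nat) (E : {set {set 'I_k}}) (n : nat) (G : seq {set 'I_n}) : bool :=
  [exists phi : {ffun 'I_k -> 'I_n},
     injectiveb phi && [forall e in E, (phi @: e) \in G]].

(* Probability that G_t^{(r,s)} (under strategy S) contains a copy of H: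
   U_1..U_t are i.i.d. uniform r-subsets of [n], so this is a ratio of counts. *)
Definition prob_copy (r k : nat) (E : {set {set 'I_k}}) (S : strategy) (n t : nat) : R :=
  (INR #|[pred us : t.-tuple {set 'I_n} |
            all (fun U : {set 'I_n} => #|U| == r) (tval us) && has_copy E (process_edges S (tval us))]|
   / INR #|[pred us : t.-tuple {set 'I_n} | all (fun U : {set 'I_n} => #|U| == r) (tval us)]|)%R.

Definition aas (p : nat -> R) : Prop :=
  forall eps : R, (0 < eps)%R -> exists N : nat, forall n : nat, (N <= n)%N ->
    (Rabs (p n - 1) < eps)%R.

Definition little_o (b a : nat -> R) : Prop :=
  forall eps : R, (0 < eps)%R -> exists N : nat, forall n : nat, (N <= n)%N ->
    (Rabs (b n) <= eps * Rabs (a n))%R.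

Definition tau_le (r s k : nat) (E : {set {set 'I_k}}) (f : nat -> R) : Prop :=
  exists S : strategy, valid_strategy r s S /\
    forall t : nat -> nat, little_o f (fun n => INR (t n)) ->
      aas (fun n => prob_copy r E S n (t n)).

Definition tau_ge (r s k : nat) (E : {set {set 'I_k}}) (f : nat -> R) : Prop :=
  forall S : strategy, valid_strategy r s S ->
    forall t : nat -> nat, little_o (fun n => INR (t n)) f ->
      aas (fun n => (1 - prob_copy r E S n (t n))%R).

Definition tau_eq (r s k : nat) (E : {set {set 'I_k}}) (f : nat -> R) : Prop :=
  tau_le r s E f /\ tau_ge r s E f.

Definition is_starplus (s c l1 l2 k : nat) (E : {set {set 'I_k}}) (C : {set 'I_k}) : Prop :=
  [/\ (forall e, e \in E -> #|e| = s),
      (1 <= c < s)%N /\ #|C| = c,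
      #|[set e in E | C \subset e]| = l1,
      \bigcup_(e in E | C \subset e) e = [set: 'I_k]
    & #|[set e in E | ~~ (C \subset e)]| = l2].

(* Edges of the flower H_1 (its vertex set is ~: C). *)
Definition flower_edges (k : nat) (E : {set {set 'I_k}}) (C : {set 'I_k}) : {set {set 'I_k}} :=
  [set e :\: C | e in E & C \subset e].

(* g(F) for an r-uniform hypergraph with v vertices and e >= 1 edges. *)
Definition gdens (r v e : nat) : R :=
  if e == 1%N then (1 / INR r)%R else (INR (e - 1) / (INR v - INR r))%R.

Definition edge_balanced (r k : nat) (W0 : {set 'I_k}) (F : {set {set 'I_k}}) : Prop :=
  forall (W : {set 'I_k}) (F' : {set {set 'I_k}}),
    W \subset W0 -> F' \subset F -> (forall f, f \in F' -> f \subset W) ->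
    (0 < #|F'|)%N -> (gdens r #|W| #|F'| <= gdens r #|W0| #|F|)%R.

(* Main.v *)
(** Write v = k - s + r for the number of vertices of the flower, m = l1 + l2,
    x = n^(-v/m) and f = n^r x, so that n^v x^m = 1.

    Lower bound: a copy is determined by the m arrival times, by the placement of
    its earliest edge and by the k - s remaining vertices, and each later random
    r-set must fall inside its edge.  By the union bound a copy appears with
    probability O(t^m n^(k-s) n^(-r(m-1))) = O((t/f)^m).

    Upper bound: only embeddings sending each non-central vertex into its own block
    of about n/k vertices, and the center to a fixed set, are considered; two of
    them then overlap exactly where they agree.  In the first phase, of length of
    order f, the player completes each r-set by the fixed center, so that flowers
    appear as in a random r-uniform hypergraph; by edge-balancedness the second
    moment method gives about n^v x^l1 of them.  The condition on
    (l1 + l2) / (l1 - 1) says that the expected number of pairs of flowers sharing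
    at least r vertices has at most the same order, so by a Turan argument a
    positive proportion of the flowers pairwise share fewer than r vertices.  In
    the second phase an r-set contained in a selected flower determines that
    flower, and the player builds the j-th cap edge from a fixed r-subset of it at
    times congruent to j modulo l2.  If the second phase has length K f, about
    K^l2 selected flowers are completed, and a second application of the second
    moment method concludes. *)

From Stdlib Require Import Reals.
From mathcomp Require Import all_boot all_order all_algebra archimedean.
From mathcomp Require Import ring lra zify.
From mathcomp Require Import Rstruct.
Require Import Defs.
Set Implicit Arguments. Unset Strict Implicit. Unset Printing Implicit Defensive.
Import Order.TTheory GRing.Theory Num.Theory.

(** * Independent sets *)

Section IndependentSet.
Variables (A : finType) (D : rel A).

Definition independent (X : {set A}) :=
  [forall a in X, forall b in X, D a b ==> (a == b)].

Lemma independentP (X : {set A}) :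
  reflect {in X &, forall a b, D a b -> a = b} (independent X).
Proof.
apply: (iffP forall_inP) => [h a b aX bX Dab|h a aX].
  by have /forall_inP/(_ b bX)/implyP/(_ Dab)/eqP := h a aX.
by apply/forall_inP => b bX; apply/implyP => /(h a b aX bX) ->.
Qed.

(** A deterministic choice of a largest independent subset, so that the player can recompute it at
    every step from the same data. *)
Definition max_indep (S : {set A}) : {set A} :=
  [arg max_(X > set0 | (X \subset S) && independent X) #|X|].

Lemma max_indepP (S : {set A}) :
  [/\ max_indep S \subset S, independent (max_indep S) &
    forall X : {set A}, X \subset S -> independent X -> #|X| <= #|max_indep S|].
Proof.
rewrite /max_indep; case: arg_maxnP => [|X /andP[XS iX] maxX].
  by rewrite sub0set; apply/independentP => a b; rewrite inE.
by split=> // Y YS iY; apply: maxX; rewrite YS.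
Qed.

Hypotheses (Drefl : reflexive D) (Dsym : symmetric D).

(* Turan-type bound: at least half of [S] has at most twice the average degree,
   and a maximal independent subset of that half dominates it. *)
Lemma max_indep_lb (S : {set A}) :
  #|S| ^ 2 <= 4 * (\sum_(a in S) \sum_(b in S | D a b) 1) * #|max_indep S|.
Proof.
set B := \sum_(a in S) _; pose deg a := \sum_(b in S | D a b) 1.
pose Low := [set a in S | deg a * #|S| <= 2 * B].
have LowS : Low \subset S by apply/subsetP => a; rewrite inE => /andP[].
have SB : #|S| <= B.
  rewrite -sum1_card; apply: leq_sum => a aS.
  by rewrite (bigD1 a) /= ?aS ?Drefl.
(* Markov's inequality for degrees: an element outside [Low] has degree times [#|S|] at least
   [2 * B + 1], while all degrees sum to [B]. *)
have half : #|S| <= 2 * #|Low|.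
  have : #|S :\: Low| * (2 * B).+1 <= B * #|S|.
    rewrite -sum_nat_const; apply: leq_trans (_ : \sum_(a in S :\: Low) deg a * #|S| <= _).
      by apply: leq_sum => a; rewrite !inE negb_and => /andP[/orP[/negP//|]]; rewrite -ltnNge.
    rewrite -big_distrl leq_mul2r /B; apply/orP; right.
    rewrite [leqRHS](big_setID Low) /= (setIidPr LowS); exact: leq_addl.
  have := cardsID Low S; rewrite (setIidPr LowS); nia.
have i0 : (set0 \subset Low) && independent set0.
  by rewrite sub0set; apply/independentP => a b; rewrite inE.
have [X /maxsetP[/andP[XLow iX] maxX] _] := maxset_exists
  (P := fun X : {set A} => (X \subset Low) && independent X) i0.
have dom : #|Low| <= \sum_(c in X) deg c.
  apply: leq_trans (_ : #|\bigcup_(c in X) [set b in S | D c b]| <= _).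
    apply/subset_leq_card/subsetP => a aLow; apply/bigcupP.
    have aS := subsetP LowS a aLow.
    case: (boolP [exists c in X, D c a]) => [/exists_inP[c cX Dca]|/exists_inPn nD].
      by exists c => //; rewrite inE aS.
    (* An element without neighbour in [X] could be added to [X], so maximality already puts it
       there. *)
    have aX : a \in X.
      rewrite -(maxX (a |: X)) ?setU11 ?subsetUr // subUset sub1set aLow XLow /=.
      apply/independentP => b c; rewrite !in_setU1.
      move=> /predU1P[->|bX] /predU1P[->|cX] //; first by rewrite Dsym (negPf (nD c cX)).
        by rewrite (negPf (nD b bX)).
      exact: (independentP _ iX).
    by exists a => //; rewrite inE aS Drefl.
  elim/big_rec2: _ => [|c n U cX IH]; first by rewrite cards0.
  rewrite (leq_trans (leq_card_setU _ _)) // leq_add // /deg -sum1_card.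
  by apply: eq_leq; apply: eq_bigl => b; rewrite inE.
have : #|Low| * #|S| <= #|X| * (2 * B).
  apply: leq_trans (_ : (\sum_(c in X) deg c) * #|S| <= _); first by rewrite leq_mul2r dom orbT.
  rewrite big_distrl -sum_nat_const; apply: leq_sum => c cX.
  by have := subsetP XLow c cX; rewrite inE => /andP[].
have [_ _ /(_ X (subset_trans XLow LowS) iX)] := max_indepP S.
nia.
Qed.
End IndependentSet.

(** * The process and the strategy *)

Section Process.
Variables (n : nat) (S : strategy).
Implicit Types (us : seq {set 'I_n}) (h : seq ({set 'I_n} * {set 'I_n})).

Definition edge_at us i : {set 'I_n} :=
  nth set0 us i :|: S (run_hist S [::] (take i us)) (nth set0 us i).

Lemma run_hist_rcons h us U :
  run_hist S h (rcons us U) = rcons (run_hist S h us) (U, S (run_hist S h us) U).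
Proof. by elim: us h => //= V us IH h; rewrite IH. Qed.

Lemma unzip1_run_hist us : unzip1 (run_hist S [::] us) = us.
Proof. by elim/last_ind: us => //= us U IH; rewrite run_hist_rcons /unzip1 map_rcons -/(unzip1 _) IH. Qed.

Lemma process_edgesE us : process_edges S us = [seq edge_at us i | i <- iota 0 (size us)].
Proof.
elim/last_ind: us => //= us U IH; rewrite /process_edges run_hist_rcons map_rcons.
rewrite size_rcons -addn1 iotaD map_cat cats1 /=; congr rcons.
  rewrite [LHS]IH; apply/eq_in_map => i; rewrite mem_iota add0n => /andP[_ iu].
  by rewrite /edge_at nth_rcons iu -cats1 takel_cat // ltnW.
by rewrite /edge_at add0n nth_rcons ltnn eqxx -cats1 take_size_cat.
Qed.

Lemma mem_process_edges us e :
  reflect (exists2 i, i < size us & e = edge_at us i) (e \in process_edges S us).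
Proof.
rewrite process_edgesE; apply: (iffP mapP) => -[i].
  by rewrite mem_iota add0n => /andP[_ iu] ->; exists i.
by move=> iu ->; exists i => //; rewrite mem_iota.
Qed.

(** Causality of the process, with times counted from 0. It makes an edge independent of the later
    random sets in the lower bound. *)
Lemma eq_edge_at us us' i : take i.+1 us = take i.+1 us' -> edge_at us i = edge_at us' i.
Proof.
move=> e; rewrite /edge_at -(nth_take set0 (ltnSn i) us) e nth_take //.
by rewrite -(take_takel us (leqnSn i)) e take_takel.
Qed.
End Process.

(** * Strategies described by the whole edge aimed at *)

Section TargetStrategy.
Variables (r s : nat) (target : forall n, seq {set 'I_n} -> {set 'I_n} -> {set 'I_n}).
Hypothesis rs : r <= s.

(* The fallback makes the strategy legal on every history, including those that
   it never produces itself. *)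
Definition target_strategy : strategy := fun n hist U =>
  let e := target (unzip1 hist) U in
  if (U \subset e) && (#|e| == s) then e :\: U
  else odflt set0 [pick V : {set 'I_n} | (V \subset ~: U) && (#|V| == s - r)].

Lemma target_strategy_valid : valid_strategy r s target_strategy.
Proof.
move=> n sn hist U cU; rewrite /target_strategy.
case: ifP => [/andP[Ue /eqP ce]|_].
  by rewrite setDE subsetIr -setDE cardsD (setIidPr Ue) ce cU.
case: pickP => [V /andP[-> /eqP ->] //|none].
have [V VU cV] : exists2 V : {set 'I_n}, V \subset ~: U & #|V| = s - r.
  have : s - r <= #|~: U| by rewrite cardsCs setCK card_ord cU leq_sub2r.
  move=> le; have : 0 < #|[set V : {set 'I_n} | V \subset ~: U & #|V| == s - r]|.
    by rewrite cards_draws bin_gt0.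
  by rewrite card_gt0 => /set0Pn[V]; rewrite inE => /andP[VU /eqP cV]; exists V.
by have := none V; rewrite VU cV eqxx.
Qed.

(** The first components of the history are exactly the past random sets, so a target computed from
    these alone is enough to play; the player's own past moves can be recomputed. *)
Lemma edge_at_target n (us : seq {set 'I_n}) i :
  let e := target (take i us) (nth set0 us i) in
  nth set0 us i \subset e -> #|e| = s -> edge_at target_strategy us i = e.
Proof.
move=> e Ue ce; rewrite /edge_at /target_strategy unzip1_run_hist Ue ce eqxx /=.
by rewrite setDE setUIr setUCr setIT (setUidPr Ue).
Qed.
End TargetStrategy.

(** * Embeddings with one block per vertex *)

Section Embeddings.

Variables (k n : nat) (C : {set 'I_k}) (part : 'I_k -> {set 'I_n}).
Hypothesis part_disj : forall x y z, z \in part x -> z \in part y -> x = y.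
Hypothesis part_center : forall x, x \in C -> #|part x| = 1.

(** Disjoint parts make these maps injective, and singleton parts on [C] give all of them the same
    central set. *)
Definition emb : {set {ffun 'I_k -> 'I_n}} :=
  [set phi : {ffun 'I_k -> 'I_n} | [forall x, phi x \in part x]].

Definition agree (phi psi : {ffun 'I_k -> 'I_n}) : {set 'I_k} :=
  [set x in ~: C | phi x == psi x].

Implicit Types phi psi : {ffun 'I_k -> 'I_n}.

Lemma embP phi : reflect (forall x, phi x \in part x) (phi \in emb).
Proof. by rewrite inE; apply: forallP. Qed.

Lemma emb_inj2 phi psi x y : phi \in emb -> psi \in emb -> phi x = psi y -> x = y.
Proof.
move=> /embP hp /embP hq e; apply: (part_disj (hp x)).
by rewrite e; apply: hq.
Qed.

Lemma emb_inj phi : phi \in emb -> injective phi.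
Proof. by move=> hp x y; apply: emb_inj2. Qed.

Lemma emb_imset_sub phi psi (e e' : {set 'I_k}) : phi \in emb -> psi \in emb ->
  phi @: e \subset psi @: e' -> {in e, phi =1 psi} /\ e \subset e'.
Proof.
move=> hp hq /subsetP s.
have h x : x \in e -> phi x = psi x /\ x \in e'.
  move=> xe; have /imsetP[y ye' exy] := s _ (imset_f phi xe).
  by have xy := emb_inj2 hp hq exy; rewrite {1}exy -xy in ye' *.
by split=> [x /h[]|] //; apply/subsetP => x /h[].
Qed.

(** Disjoint parts turn [phi x = psi y] into [x = y], so images can coincide only pointwise. Every
    overlap of two embeddings is thus described by the single set [agree phi psi]. *)
Lemma emb_imset_agree phi psi (e : {set 'I_k}) : phi \in emb -> psi \in emb ->
  e \subset ~: C -> (phi @: e == psi @: e) = (e \subset agree phi psi).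
Proof.
move=> hp hq eC; apply/eqP/subsetP => [eq x xe|s].
  have sub : phi @: e \subset psi @: e by rewrite eq.
  have [h _] := emb_imset_sub hp hq sub.
  by rewrite inE (subsetP eC) // h /=.
by apply: eq_in_imset => x /s; rewrite inE => /andP[_ /eqP].
Qed.

Definition center_image : {set 'I_n} := \bigcup_(x in C) part x.

Lemma emb_center phi : phi \in emb -> phi @: C = center_image.
Proof.
move=> /embP hp; apply/setP => z; apply/imsetP/bigcupP => -[x xC].
  by move=> ->; exists x.
have /eqP/cards1P[y e] := part_center xC.
have := hp x; rewrite e !inE => /eqP ex /eqP ->.
by exists x.
Qed.
End Embeddings.

(** * The two-phase strategy for a starplus *)

Section StarplusStrategy.
Variables (k r s l1 l2 : nat) (E : {set {set 'I_k}}) (C : {set 'I_k}).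
Variables (ray : 'I_l1 -> {set 'I_k}) (cap tmpl : nat -> {set 'I_k}).
Variables (part : forall n, 'I_k -> {set 'I_n}) (w1 : nat -> nat).

(** The flowers found in phase one. The [j]-th ray must arrive in the [j]-th of [l1] disjoint
    windows of length [w1 n], which makes the rays independent events. *)
Definition alive n (us : seq {set 'I_n}) : {set {ffun 'I_k -> 'I_n}} :=
  [set phi in emb (@part n) | [forall j : 'I_l1,
    [exists i : 'I_(w1 n), nth set0 us (j * w1 n + i) == phi @: ray j]]].

(** Sharing [r] flower vertices is what would allow one random [r]-set to lie in both flowers. *)
Definition conflict n (phi psi : {ffun 'I_k -> 'I_n}) : bool :=
  r <= #|agree C phi psi|.

(** Phase one completes [U] by the fixed center, and never ends when there is no cap. Afterwards the
    residue modulo [l2] tells which cap edge is being built. The default [set0], like a union in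
    which [U] meets the center, has the wrong size and so triggers the fallback of
    [target_strategy]. *)
Definition star_target n (us : seq {set 'I_n}) (U : {set 'I_n}) : {set 'I_n} :=
  if (l2 == 0) || (size us < l1 * w1 n) then U :|: center_image C (@part n)
  else let j := (size us - l1 * w1 n) %% l2 in
    if [pick phi in max_indep (@conflict n) (alive us) | phi @: tmpl j == U]
    is Some phi then phi @: cap j else set0.

Definition star_strategy : strategy := target_strategy r s star_target.

Hypotheses (r_gt0 : 0 < r) (rs : r < s).
Hypothesis cC : #|C| = s - r.
Hypothesis ray_sub : forall j, ray j \subset ~: C.
Hypothesis card_ray : forall j, #|ray j| = r.
Hypothesis card_cap : forall j, j < l2 -> #|cap j| = s.
Hypothesis card_tmpl : forall j, j < l2 -> #|tmpl j| = r.
Hypothesis tmpl_cap : forall j, j < l2 -> tmpl j \subset cap j.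
Hypothesis tmpl_sub : forall j, j < l2 -> tmpl j \subset ~: C.
Hypothesis edgesE : forall e, e \in E ->
  (exists j, e = C :|: ray j) \/ (exists2 j, j < l2 & e = cap j).

Variable n : nat.
Hypothesis part_disj : forall x y z, z \in part n x -> z \in part n y -> x = y.
Hypothesis part_center : forall x, x \in C -> #|part n x| = 1.

Lemma edge_at_ray (us : seq {set 'I_n}) i phi j : phi \in emb (@part n) ->
  i < size us -> (l2 == 0) || (i < l1 * w1 n) -> nth set0 us i = phi @: ray j ->
  edge_at star_strategy us i = phi @: (C :|: ray j).
Proof.
move=> hp iu ph eU; have inj := emb_inj part_disj hp.
have e : star_target (take i us) (nth set0 us i) = phi @: (C :|: ray j).
  rewrite /star_target size_takel ?(ltnW iu) // ph eU imsetU setUC.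
  by rewrite (emb_center part_center hp).
rewrite /star_strategy edge_at_target e //.
  by rewrite eU imsetS // subsetUr.
rewrite card_imset // cardsU cC card_ray.
have -> : C :&: ray j = set0.
  by apply/eqP; rewrite setI_eq0 disjoint_sym disjoints_subset.
by rewrite cards0; lia.
Qed.

(** Only phase one is consulted, so the selected family stays the same throughout phase two. *)
Lemma alive_take (us : seq {set 'I_n}) i : l1 * w1 n <= i -> alive (take i us) = alive us.
Proof.
move=> le; apply/setP => phi; rewrite !inE; congr (_ && _).
apply: eq_forallb => j; apply: eq_existsb => i'; rewrite nth_take //.
have := ltn_ord j; have := ltn_ord i'; nia.
Qed.

Lemma edge_at_cap (us : seq {set 'I_n}) i phi j : 
  phi \in max_indep (@conflict n) (alive us) ->
  j < l2 -> l1 * w1 n + j + l2 * i < size us ->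
  nth set0 us (l1 * w1 n + j + l2 * i) = phi @: tmpl j ->
  edge_at star_strategy us (l1 * w1 n + j + l2 * i) = phi @: cap j.
Proof.
move=> hp jl iu eU; set i0 := _ + _ + _ in iu eU *.
have [sub ind _] := max_indepP (@conflict n) (alive us).
have embF psi : psi \in max_indep (@conflict n) (alive us) -> psi \in emb (@part n).
  by move=> /(subsetP sub); rewrite inE => /andP[].
have inj := emb_inj part_disj (embF _ hp).
have e : star_target (take i0 us) (nth set0 us i0) = phi @: cap j.
  rewrite /star_target size_takel ?(ltnW iu) // ltnNge.
  have -> : (l2 == 0) = false by lia.
  have -> : l1 * w1 n <= i0 by rewrite /i0; lia.
  have -> : (i0 - l1 * w1 n) %% l2 = j.
    have -> : i0 - l1 * w1 n = i * l2 + j by rewrite /i0; lia.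
    by rewrite modnMDl modn_small.
  rewrite alive_take; last by rewrite /i0; lia.
  rewrite eU /=; case: pickP => [psi /andP[hq /eqP eq]|none]; last first.
    by have := none phi; rewrite hp eqxx.
  (* Both selected embeddings send [tmpl j] to the same set, so they agree on [r] vertices and
     conflict; independence identifies them. *)
  have -> // : psi = phi.
  apply: (independentP _ _ ind) => //; rewrite /conflict -(card_tmpl jl).
  by apply: subset_leq_card; rewrite -(emb_imset_agree part_disj) ?embF ?eq ?tmpl_sub.
rewrite /star_strategy edge_at_target e //.
  by rewrite eU imsetS // tmpl_cap.
by rewrite card_imset // card_cap.
Qed.

(** The deterministic criterion behind both probability bounds: every ray arrives in phase one, and
    every template is hit at a time of the right residue. *)
Lemma has_copy_emb (us : seq {set 'I_n}) phi : phi \in emb (@part n) ->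
  (forall j, exists i, [/\ i < size us, (l2 == 0) || (i < l1 * w1 n)
                         & nth set0 us i = phi @: ray j]) ->
  (forall j, j < l2 -> phi \in max_indep (@conflict n) (alive us) /\
     exists i, l1 * w1 n + j + l2 * i < size us /\
               nth set0 us (l1 * w1 n + j + l2 * i) = phi @: tmpl j) ->
  has_copy E (process_edges star_strategy us).
Proof.
move=> hp hray hcap; apply/existsP; exists phi.
rewrite (introT (injectiveP _) (emb_inj part_disj hp)) /=.
apply/forall_inP => e /edgesE[[j ->]|[j jl ->]]; apply/mem_process_edges.
  by have [i [iu ph eU]] := hray j; exists i => //; rewrite (edge_at_ray hp iu ph eU).
have [hF [i [iu eU]]] := hcap j jl.
by exists (l1 * w1 n + j + l2 * i) => //; rewrite (edge_at_cap hF jl iu eU).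
Qed.
End StarplusStrategy.

Local Open Scope ring_scope.

(** * Uniform product spaces and the second moment method *)

Section Expectation.
Variables (F : realFieldType) (I T : finType).
Hypothesis T_gt0 : (0 < #|T|)%N.
Implicit Types (X Y : {ffun I -> T} -> F) (W : {set I}) (A B : pred {ffun I -> T}).

Definition Ex X : F := (\sum_u X u) / (#|T| ^ #|I|)%:R.
Definition Pr A : F := Ex (fun u => (A u)%:R).

Lemma card_space_gt0 : 0 < (#|T| ^ #|I|)%:R :> F.
Proof. by rewrite ltr0n expn_gt0 T_gt0. Qed.

Lemma eq_Ex X Y : X =1 Y -> Ex X = Ex Y.
Proof. by move=> e; rewrite /Ex (eq_bigr Y). Qed.

Lemma Ex_le X Y : (forall u, X u <= Y u) -> Ex X <= Ex Y.
Proof.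
by move=> le; rewrite ler_pM2r ?invr_gt0 ?card_space_gt0 //; apply: ler_sum.
Qed.

Lemma Ex_ge0 X : (forall u, 0 <= X u) -> 0 <= Ex X.
Proof. by move=> h; rewrite divr_ge0 ?ler0n ?sumr_ge0. Qed.

Lemma Ex_cst c : Ex (fun=> c) = c.
Proof.
rewrite /Ex sumr_const card_ffun -[X in X / _]mulr_natr mulfK //.
by rewrite gt_eqF ?card_space_gt0.
Qed.

Lemma ExD X Y : Ex (fun u => X u + Y u) = Ex X + Ex Y.
Proof. by rewrite /Ex big_split mulrDl. Qed.

Lemma ExZ c X : Ex (fun u => c * X u) = c * Ex X.
Proof. by rewrite /Ex -mulr_sumr mulrA. Qed.

Lemma ExB X Y : Ex (fun u => X u - Y u) = Ex X - Ex Y.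
Proof. by rewrite /Ex sumrB mulrBl. Qed.

Lemma Ex_sum (J : finType) (P : pred J) (X : J -> {ffun I -> T} -> F) :
  Ex (fun u => \sum_(j | P j) X j u) = \sum_(j | P j) Ex (X j).
Proof. by rewrite /Ex exchange_big /= mulr_suml. Qed.

Lemma Pr_ge0 A : 0 <= Pr A.
Proof. by apply: Ex_ge0 => u; apply: ler0n. Qed.

Lemma Pr_le A B : (forall u, A u -> B u) -> Pr A <= Pr B.
Proof.
move=> h; apply: Ex_le => u; rewrite ler_nat.
by case: (A u) (h u) => // ->.
Qed.

Lemma Pr_le1 A : Pr A <= 1.
Proof. by rewrite -[leRHS](Ex_cst 1); apply: Ex_le => u; rewrite (ler_nat _ _ 1) leq_b1. Qed.

Lemma Pr_card A : Pr A = #|[pred u | A u]|%:R / (#|T| ^ #|I|)%:R.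
Proof.
rewrite /Pr /Ex; congr (_ / _).
rewrite -sum1_card natr_sum [RHS]big_mkcond /=.
by apply: eq_bigr => u _; rewrite inE; case: (A u).
Qed.

Lemma PrC A : Pr (fun u => ~~ A u) = 1 - Pr A.
Proof.
rewrite -[X in X - _](Ex_cst 1) -ExB; apply: eq_Ex => u.
by case: (A u); rewrite ?subrr ?subr0.
Qed.

Lemma Pr_union A B : Pr (fun u => A u || B u) <= Pr A + Pr B.
Proof.
rewrite -ExD; apply: Ex_le => u.
by rewrite -natrD ler_nat; case: (A u); case: (B u).
Qed.

Lemma markov X c : 0 < c -> (forall u, 0 <= X u) ->
  Pr (fun u => c <= X u) <= Ex X / c.
Proof.
move=> c0 X0; rewrite ler_pdivlMr // mulrC -ExZ; apply: Ex_le => u.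
case: (leP c (X u)) => h; first by rewrite mulr1.
by rewrite mulr0.
Qed.

(** The factor 4 comes from a deviation of half the mean. *)
Lemma chebyshev X : (0 < Ex X) ->
  Pr (fun u => X u < Ex X / 2%:R) <=
  4%:R * (Ex (fun u => X u ^+ 2) - Ex X ^+ 2) / Ex X ^+ 2.
Proof.
set m := Ex X => m0.
have v : Ex (fun u => (X u - m) ^+ 2) = Ex (fun u => X u ^+ 2) - m ^+ 2.
  transitivity (Ex (fun u => X u ^+ 2 - (2%:R * m * X u - m ^+ 2))).
    by apply: eq_Ex => u; ring.
  by rewrite !ExB ExZ Ex_cst -/m; ring.
rewrite -v; apply: le_trans (_ : Pr (fun u => (m / 2%:R) ^+ 2 <= (X u - m) ^+ 2) <= _).
  by apply: Pr_le => u h; rewrite -[leRHS]sqrrN ler_pXn2r ?nnegrE //; lra.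
apply: le_trans (markov _ _) _; first by rewrite exprn_gt0 //; lra.
  by move=> u; apply: sqr_ge0.
by rewrite expr_div_n invf_div mulrCA mulrA -natrX.
Qed.

Definition depends_on W X := forall u u' : {ffun I -> T},
  (forall i, i \in W -> u i = u' i) -> X u = X u'.

Lemma depends_onW W W' X : W \subset W' -> depends_on W X -> depends_on W' X.
Proof. by move=> /subsetP s h u u' e; apply: h => i /s; apply: e. Qed.

(* On pairs of samples, exchanging the coordinates outside [W] is an involution
   which turns [X u * Y u'] into [X z * Y z]. *)
Lemma Ex_indep W X Y : depends_on W X -> depends_on (~: W) Y ->
  Ex (fun u => X u * Y u) = Ex X * Ex Y.
Proof.
move=> hX hY.
pose mix (u u' : {ffun I -> T}) := [ffun i => if i \in W then u i else u' i].
pose sw (p : {ffun I -> T} * {ffun I -> T}) := (mix p.1 p.2, mix p.2 p.1).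
have swK : involutive sw.
  by move=> [u u']; congr (_, _); apply/ffunP => i; rewrite !ffunE /=; case: (i \in W).
have e : (\sum_u X u) * (\sum_u Y u)
       = (\sum_u X u * Y u) * (#|T| ^ #|I|)%:R.
  rewrite big_distrlr /= pair_big /=.
  pose G (p : {ffun I -> T} * {ffun I -> T}) := X p.1 * Y p.1.
  transitivity (\sum_p G (sw p)).
    apply: eq_bigr => -[u u'] _ /=; congr (_ * _).
      by apply: hX => i iW; rewrite ffunE iW.
    by apply: hY => i; rewrite inE ffunE => /negbTE ->.
  rewrite -[LHS](reindex_inj (inv_inj swK) (P := predT) (F := G)) /=.
  rewrite -(pair_big predT predT (fun u _ => X u * Y u)) /=.
  by under eq_bigr do rewrite sumr_const card_ffun -mulr_natr; rewrite -mulr_suml.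
have n0 : (#|T| ^ #|I|)%:R != 0 :> F by rewrite gt_eqF ?card_space_gt0.
by rewrite /Ex mulf_div e -mulf_div divff // mulr1.
Qed.

End Expectation.

(** * Two-sided estimates for the hitting probability *)

Section Bernoulli.
Variable F : realFieldType.

Lemma bernoulli (x : F) w : -1 <= x -> 1 + w%:R * x <= (1 + x) ^+ w.
Proof.
move=> x1; elim: w => [|w IH]; first by rewrite mul0r addr0 expr0.
rewrite exprS; apply: le_trans (_ : (1 + x) * (1 + w%:R * x) <= _).
  by have := ler0n F w; rewrite -natr1; nra.
by rewrite ler_wpM2l //; lra.
Qed.

(* Probability that [w] uniform draws among [N] values hit a given value. *)
Definition hitp (N w : nat) : F := 1 - (1 - N%:R^-1) ^+ w.

Variables (N w : nat).
Hypothesis N_gt0 : (0 < N)%N.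

Lemma invN_bounds : 0 < N%:R^-1 :> F /\ N%:R^-1 <= 1 :> F.
Proof. by split; rewrite ?invr_gt0 ?invf_le1 ?ltr0n ?ler1n. Qed.

Lemma hitp_ge0 : 0 <= hitp N w.
Proof. by have [h1 h2] := invN_bounds; rewrite subr_ge0 exprn_ile1 //; lra. Qed.

Lemma hitp_le : hitp N w <= w%:R / N%:R.
Proof.
have [h1 h2] := invN_bounds; rewrite /hitp.
by have := @bernoulli (- N%:R^-1) w; lra.
Qed.

(** With [p = w / N <= 1], the product of [(1 - 1/N)^w] and [(1 + 1/N)^w] is at most 1 and the
    second factor is at least [1 + p]. The hitting probability is therefore at least
    [p / (1 + p) >= p / 2]. *)
Lemma hitp_ge : (w <= N)%N -> w%:R / N%:R / 2%:R <= hitp N w.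
Proof.
move=> wN; have [h1 h2] := invN_bounds; rewrite /hitp.
have b := @bernoulli N%:R^-1 w.
have : (1 - N%:R^-1) ^+ w * (1 + N%:R^-1) ^+ w <= 1 :> F.
  by rewrite -exprMn exprn_ile1 //; nra.
have : 0 <= (1 - N%:R^-1) ^+ w :> F by rewrite exprn_ge0 //; lra.
have p0 : 0 <= w%:R / N%:R :> F by rewrite divr_ge0 ?ler0n.
have p1 : w%:R / N%:R <= 1 :> F by rewrite ler_pdivrMr ?ltr0n // mul1r ler_nat.
move: ((1 - N%:R^-1) ^+ w) ((1 + N%:R^-1) ^+ w) b p0 p1 => z y.
move: (w%:R / N%:R) => p b p0 p1 z0 zy.
have : 1 + p <= y by lra.
nra.
Qed.
End Bernoulli.

(** * Hitting prescribed values inside time windows *)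

Section Hits.
Variables (F : realFieldType) (I T : finType).
Hypothesis T_gt0 : (0 < #|T|)%N.
Local Notation Ex := (@Ex F I T).
Local Notation Pr := (@Pr F I T).
Local Notation q w := (hitp F #|T| w).

Lemma Ex_prod_coord (G : I -> T -> F) :
  Ex (fun u => \prod_i G i (u i)) = \prod_i ((\sum_x G i x) / #|T|%:R).
Proof.
by rewrite /Ex -bigA_distr_bigA big_split /= prodr_const exprVn natrX.
Qed.

Lemma Pr_in_window (W : {set I}) (B : pred T) :
  Pr (fun u => [forall i in W, B (u i)]) = (#|B|%:R / #|T|%:R) ^+ #|W|.
Proof.
pose G i x : F := if i \in W then (B x)%:R else 1.
transitivity (Ex (fun u => \prod_i G i (u i))).
  apply: eq_Ex => u; case: (boolP [forall i in W, B (u i)]) => [/forall_inP h|].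
    by rewrite big1 // => i _; rewrite /G; case: ifP => // /h ->.
  case/forall_inPn => i iW nB; rewrite (bigD1 i) //= /G iW (negbTE nB).
  by rewrite mul0r.
rewrite Ex_prod_coord -prodr_const [RHS]big_mkcond /=; apply: eq_bigr => i _.
rewrite /G; case: ifP => _.
  rewrite -natr_sum (_ : \sum_x B x = #|B|)%N // -sum1_card [RHS]big_mkcond.
  by apply: eq_bigr => x _; rewrite unfold_in; case: (B x).
by rewrite sumr_const cardT -cardE divff // pnatr_eq0 -lt0n.
Qed.

Lemma depends_on_prod (J : finType) (s : seq J) (W' : {set I}) (X : J -> {ffun I -> T} -> F) :
  (forall j, j \in s -> depends_on W' (X j)) ->
  depends_on W' (fun u => \prod_(j <- s) X j u).
Proof.
by move=> h u u' e; apply: eq_big_seq => j js; apply: h.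
Qed.

Lemma Ex_prod (J : finType) (W : J -> {set I}) (X : J -> {ffun I -> T} -> F) :
  (forall j, depends_on (W j) (X j)) ->
  (forall j j', j != j' -> [disjoint W j & W j']) ->
  Ex (fun u => \prod_j X j u) = \prod_j Ex (X j).
Proof.
move=> dX dW; rewrite /index_enum; case: index_enum_key; rewrite -enumT.
have := enum_uniq J; elim: (enum J) => [_|j s IH /= /andP[js us]].
  by rewrite big_nil -[RHS](Ex_cst I T_gt0 1) ; apply: eq_Ex => u; rewrite big_nil.
rewrite big_cons -(IH us) -(@Ex_indep _ _ _ T_gt0 (W j)) //.
- by apply: eq_Ex => u; rewrite big_cons.
- apply: depends_on_prod => i si; apply: (@depends_onW _ _ _ (W i)) => //.
  rewrite -disjoints_subset; apply: dW.
  by apply: contraNneq js => <-.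
Qed.

Definition hit (W : {set I}) (x : T) (u : {ffun I -> T}) := [exists i in W, u i == x].

Lemma depends_on_hit (W : {set I}) x (u u' : {ffun I -> T}) :
  (forall i, i \in W -> u i = u' i) -> hit W x u = hit W x u'.
Proof. by move=> e; apply: eq_existsb_in => i /e ->. Qed.

Lemma Pr_hit (W : {set I}) x : Pr (hit W x) = q #|W|.
Proof.
have -> : Pr (hit W x) = 1 - Pr (fun u => ~~ hit W x u) by rewrite PrC //; ring.
congr (1 - _); rewrite (_ : Pr _ = Pr (fun u => [forall i in W, predC1 x (u i)])).
  by rewrite Pr_in_window cardC1 -subn1 natrB // mulrBl divff ?mul1r // pnatr_eq0 -lt0n.
by apply: eq_Ex => u; rewrite negb_exists_in.
Qed.

(** Negative correlation: by inclusion and exclusion it reduces to [1 - 2/N <= (1 - 1/N)^2]. *)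
Lemma Pr_hit2 (W : {set I}) x y : x != y ->
  Pr (fun u => hit W x u && hit W y u) <= q #|W| ^+ 2.
Proof.
move=> xy.
pose miss (B : pred T) (u : {ffun I -> T}) := [forall i in W, ~~ B (u i)].
have e : Pr (fun u => hit W x u && hit W y u)
    = Pr (hit W x) + Pr (hit W y) - 1 + Pr (miss (pred2 x y)).
  rewrite -[X in _ - X + _](Ex_cst I T_gt0 1) -ExD -ExB -ExD; apply: eq_Ex => u.
  have -> : miss (pred2 x y) u = ~~ hit W x u && ~~ hit W y u.
    rewrite !negb_exists_in; apply/forall_inP/andP.
      by move=> h; split; apply/forall_inP => i /h; rewrite negb_or => /andP[].
    by move=> [/forall_inP h1 /forall_inP h2] i iW; rewrite negb_or h1 ?h2.
  by case: (hit W x u); case: (hit W y u) => /=; ring.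
rewrite e !Pr_hit (Pr_in_window W (predC (pred2 x y))).
have c2 : (#|pred2 x y| = 2)%N by rewrite card2 xy.
have cT : (2 <= #|T|)%N by rewrite -c2 max_card.
have -> : #|predC (pred2 x y)|%:R = #|T|%:R - 2%:R :> F.
  by rewrite -natrB // -(cardC (pred2 x y)) c2 addKn.
have n0 : #|T|%:R != 0 :> F by rewrite pnatr_eq0 -lt0n.
suff : ((#|T|%:R - 2%:R) / #|T|%:R) ^+ #|W| <= ((1 - #|T|%:R^-1) ^+ #|W|) ^+ 2 :> F.
  by rewrite /hitp; nra.
have c : 0 <= #|T|%:R - 2%:R :> F by rewrite subr_ge0 ler_nat.
rewrite -exprM mulnC exprM; apply: lerXn2r.
- by rewrite nnegrE divr_ge0.
- by rewrite nnegrE sqr_ge0.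
by rewrite mulrBl divff // ; have := sqr_ge0 (#|T|%:R^-1 : F); nra.
Qed.

(** * Second moment of the number of fully hit targets *)

Section SecondMoment.
Variables (A J : finType) (A0 : {set A}) (W : J -> {set I}) (R : A -> J -> T) (w : nat).
Hypothesis cW : forall j, #|W j| = w.
Hypothesis dW : forall j j', j != j' -> [disjoint W j & W j'].

Definition all_hit (a : A) (u : {ffun I -> T}) := [forall j, hit (W j) (R a j) u].
Definition num_hit (u : {ffun I -> T}) : nat := #|[set a in A0 | all_hit a u]|.
Definition agreement (a b : A) : nat := #|[set j | R a j == R b j]|.

Lemma eq_all_hit a (u u' : {ffun I -> T}) :
  (forall j i, i \in W j -> u i = u' i) -> all_hit a u = all_hit a u'.
Proof. by move=> e; apply: eq_forallb => j; apply: depends_on_hit => i /e. Qed.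

Lemma eq_num_hit (u u' : {ffun I -> T}) :
  (forall j i, i \in W j -> u i = u' i) -> num_hit u = num_hit u'.
Proof. by move=> e; apply: eq_card => a; rewrite !inE (eq_all_hit a e). Qed.

Lemma Pr_forall_window (B : J -> pred {ffun I -> T}) :
  (forall j (u u' : {ffun I -> T}), (forall i, i \in W j -> u i = u' i) -> B j u = B j u') ->
  Pr (fun u => [forall j, B j u]) = \prod_j Pr (B j).
Proof.
move=> dB; rewrite -(@Ex_prod _ W) //; last by move=> j u u' /dB ->.
apply: eq_Ex => u; case: (boolP [forall j, B j u]) => [/forallP h|].
  by rewrite big1 // => j _; rewrite h.
by case/forallPn => j nB; rewrite (bigD1 j) //= (negbTE nB) mul0r.
Qed.

Lemma Pr_all_hit a : Pr (all_hit a) = q w ^+ #|J|.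
Proof.
rewrite Pr_forall_window.
  by under eq_bigr => j _ do rewrite Pr_hit cW; rewrite prodr_const.
by move=> j u u'; apply: depends_on_hit.
Qed.

(** Windows are independent. One in which [a] and [b] ask for the same value contributes one factor
    [q w], any other at most two. *)
Lemma Pr_all_hit2 a b :
  Pr (fun u => all_hit a u && all_hit b u) <= q w ^+ (2 * #|J| - agreement a b).
Proof.
rewrite (_ : Pr _ = Pr (fun u => [forall j, hit (W j) (R a j) u && hit (W j) (R b j) u])).
  rewrite Pr_forall_window; last first.
    by move=> j u u' h; rewrite !(depends_on_hit _ h).
  have -> : (2 * #|J| - agreement a b = \sum_j (if R a j == R b j then 1 else 2))%N.
    have eag : (agreement a b = \sum_j (R a j == R b j))%N.
      rewrite /agreement -sum1_card [LHS]big_mkcond; apply: eq_bigr => j _.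
      by rewrite inE; case: eqP.
    apply: (@addIn (agreement a b)); rewrite subnK.
      rewrite [in RHS]eag -big_split /= (eq_bigr (fun=> 2)) ?sum_nat_const 1?mulnC //.
      by move=> j _; case: eqP.
    by rewrite mul2n -addnn; apply: leq_trans (max_card _) (leq_addr _ _).
  rewrite -prodrXr; apply: ler_prod => j _; rewrite Pr_ge0 //=.
  case: eqP => [->|/eqP ne]; last by rewrite -(cW j) Pr_hit2.
  by rewrite expr1 -(cW j) -(Pr_hit _ (R b j)); apply: Pr_le => // u /andP[].
apply: eq_Ex => u; congr ((nat_of_bool _)%:R); apply/andP/forallP.
  by move=> [/forallP h1 /forallP h2] j; rewrite h1 h2.
by move=> h; split; apply/forallP => j; have /andP[] := h j.
Qed.

Lemma num_hitE u : (num_hit u)%:R = \sum_(a in A0) (all_hit a u)%:R :> F.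
Proof.
rewrite /num_hit -sum1_card natr_sum big_mkcond [RHS]big_mkcond /=.
by apply: eq_bigr => a _; rewrite inE; case: (a \in A0); case: (all_hit a u).
Qed.

Lemma Ex_num_hit : Ex (fun u => (num_hit u)%:R) = #|A0|%:R * q w ^+ #|J|.
Proof.
under eq_Ex do rewrite num_hitE.
rewrite Ex_sum (eq_bigr (fun=> q w ^+ #|J|)); last by move=> a _; apply: Pr_all_hit.
by rewrite sumr_const -[LHS]mulr_natl.
Qed.

Lemma Ex_num_hit2 (D : rel A) :
  Ex (fun u => \sum_(a in A0) \sum_(b in A0 | D a b) (all_hit a u && all_hit b u)%:R)
  <= \sum_(a in A0) \sum_(b in A0 | D a b) q w ^+ (2 * #|J| - agreement a b).
Proof.
rewrite Ex_sum; apply: ler_sum => a _; rewrite Ex_sum; apply: ler_sum => b _.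
exact: Pr_all_hit2.
Qed.

(** Pairs without agreement contribute at most [q w ^+ (2 * #|J|)] each, which the squared mean
    cancels. *)
Lemma var_num_hit :
  Ex (fun u => (num_hit u)%:R ^+ 2) - Ex (fun u => (num_hit u)%:R) ^+ 2 <=
  \sum_(a in A0) \sum_(b in A0 | (0 < agreement a b)%N) q w ^+ (2 * #|J| - agreement a b).
Proof.
have -> : Ex (fun u => (num_hit u)%:R ^+ 2) =
  Ex (fun u => \sum_(a in A0) \sum_(b in A0 | true) (all_hit a u && all_hit b u)%:R).
  apply: eq_Ex => u; rewrite num_hitE expr2 big_distrlr /=.
  apply: eq_bigr => a _; rewrite [RHS](eq_bigl (mem A0)); last by move=> b; rewrite andbT.
  by apply: eq_bigr => b _; rewrite -natrM mulnb.
rewrite lerBlDr; apply: le_trans (Ex_num_hit2 (fun _ _ => true)) _.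
have -> : Ex (fun u => (num_hit u)%:R) ^+ 2 =
    \sum_(a in A0) \sum_(b in A0) q w ^+ (2 * #|J|).
  by rewrite Ex_num_hit !sumr_const -[RHS]mulr_natl -[X in _ = _ * X]mulr_natl mulnC exprM; ring.
rewrite -big_split; apply: ler_sum => a _ /=.
rewrite (eq_bigl (mem A0)); last by move=> b; rewrite andbT.
rewrite (bigID (fun b => (0 < agreement a b)%N)) /= lerD2l.
rewrite [leRHS](bigID (fun b => (0 < agreement a b)%N)) /=.
rewrite -[leLHS]add0r lerD //.
  by apply: sumr_ge0 => b _; rewrite exprn_ge0 ?hitp_ge0.
by apply: ler_sum => b /andP[_]; rewrite -eqn0Ngt => /eqP ->; rewrite subn0.
Qed.

End SecondMoment.
End Hits.

(** * Failure probability of the strategy for fixed n *)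

(** Conditioning on [f], which is read off the coordinates in [W]: for each fixed value, failure
    concerns the other coordinates and is independent of that value being taken. This links the two
    phases. *)
Lemma Pr_cond (F : realFieldType) (I T A : finType) (W : {set I}) (d : F)
    (f : {ffun I -> T} -> A) (good : pred A) (fail : A -> pred {ffun I -> T}) :
  (0 < #|T|)%N -> 0 <= d ->
  (forall u u' : {ffun I -> T}, (forall i, i \in W -> u i = u' i) -> f u = f u') ->
  (forall a (u u' : {ffun I -> T}), (forall i, i \in ~: W -> u i = u' i) -> fail a u = fail a u') ->
  (forall a, good a -> Pr F (fail a) <= d) ->
  Pr F (fun u => good (f u) && fail (f u) u) <= d.
Proof.
move=> T0 d0 df dfail bound.
have -> : Pr F (fun u => good (f u) && fail (f u) u) =
    Ex (fun u => \sum_(a | good a) (f u == a)%:R * (fail a u)%:R).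
  apply: eq_Ex => u; case: (boolP (good (f u))) => [g|ng] /=.
    rewrite (bigD1 (f u)) //= eqxx mul1r big1 ?addr0 // => a /andP[_].
    by rewrite eq_sym => /negbTE ->; rewrite mul0r.
  rewrite big1 // => a ga; case: eqP => [e|_]; last by rewrite mul0r.
  by rewrite e ga in ng.
rewrite Ex_sum; apply: le_trans (_ : \sum_(a | good a) Pr F (fun u => f u == a) * d <= _).
  apply: ler_sum => a ga; rewrite (@Ex_indep _ _ _ T0 W).
  - by rewrite ler_wpM2l ?Pr_ge0 //; apply: bound.
  - by move=> u u' /df ->.
  - by move=> u u' /dfail ->.
rewrite -mulr_suml -[leRHS]mul1r ler_wpM2r //.
rewrite -Ex_sum -[leRHS](Ex_cst I T0 1); apply: Ex_le => // u.
rewrite big_mkcond (bigD1 (f u)) //= eqxx big1 ?addr0; first by case: ifP; rewrite ?lexx ?ler01.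
by move=> a; rewrite eq_sym => /negbTE ->; case: ifP.
Qed.

Lemma block_lt l w (j : 'I_l) (i : 'I_w) : (j * w + i < l * w)%N.
Proof.
apply: (@leq_trans (j.+1 * w)); first by rewrite mulSn addnC ltn_add2r.
by rewrite leq_mul2r ltn_ord orbT.
Qed.

(** * Random sequences of [r]-subsets and their windows *)

Section Sample.
Variables (n r t : nat).
Definition rsets := {U : {set 'I_n} | #|U| == r}.

Definition sample (u : {ffun 'I_t -> rsets}) : seq {set 'I_n} := [seq val (u i) | i <- enum 'I_t].

Lemma size_sample u : size (sample u) = t.
Proof. by rewrite size_map size_enum_ord. Qed.

Lemma nth_sample u (i : 'I_t) : nth set0 (sample u) i = val (u i).
Proof. by rewrite (nth_map i) ?size_enum_ord // nth_ord_enum. Qed.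

Lemma card_rsets : #|{: rsets}| = 'C(n, r).
Proof.
rewrite card_sig -[in RHS](card_ord n) -card_draws -cardsE.
by apply: eq_card => U; rewrite !inE.
Qed.

Variable x0 : rsets.

Definition window w (g : 'I_w -> nat) : {set 'I_t} := [set i : 'I_t | [exists y, val i == g y]].

Lemma card_window w (g : 'I_w -> nat) : (forall y, g y < t)%N -> injective g ->
  #|window g| = w.
Proof.
move=> gt ginj; rewrite -[RHS](card_ord w).
rewrite -(card_imset _ (_ : injective (fun y => Ordinal (gt y)))); last first.
  by move=> y y' /(congr1 val) /ginj.
apply: eq_card => i; rewrite inE; apply/existsP/imsetP => -[y].
  by move=> /eqP e; exists y => //; apply: val_inj.
by move=> _ ->; exists y.
Qed.

(** Translates abstract hits into the process; as [X] has [r] elements, [insubd] returns [X] itself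
    and not the default [x0]. *)
Lemma hit_window w (g : 'I_w -> nat) (X : {set 'I_n}) u : (forall y, g y < t)%N ->
  #|X| = r -> hit (window g) (insubd x0 X) u = [exists y, nth set0 (sample u) (g y) == X].
Proof.
move=> gt cX; have vX : val (insubd x0 X) = X by rewrite insubdK // unfold_in cX.
apply/exists_inP/existsP => [[i]|[y /eqP e]].
  rewrite inE => /existsP[y /eqP iy] /eqP e; exists y.
  by rewrite -iy nth_sample e vX.
exists (Ordinal (gt y)); first by rewrite inE; apply/existsP; exists y.
by rewrite -(inj_eq val_inj) vX -e -[g y]/(val (Ordinal (gt y))) nth_sample.
Qed.

Lemma insubd_inj (X Y : {set 'I_n}) : #|X| = r -> #|Y| = r ->
  insubd x0 X = insubd x0 Y -> X = Y.
Proof.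
move=> cX cY /(congr1 val).
by rewrite !insubdK // unfold_in ?cX ?cY.
Qed.
End Sample.

Section FixedN.
Variable F : realFieldType.
Variables (k r s l1 l2 : nat) (E : {set {set 'I_k}}) (C : {set 'I_k}).
Variables (ray : 'I_l1 -> {set 'I_k}) (cap tmpl : nat -> {set 'I_k}).
Variables (part : forall n, 'I_k -> {set 'I_n}) (w1 : nat -> nat).
Hypotheses (r_gt0 : (0 < r)%N) (rs : (r < s)%N).
Hypothesis cC : #|C| = (s - r)%N.
Hypothesis ray_sub : forall j, ray j \subset ~: C.
Hypothesis card_ray : forall j, #|ray j| = r.
Hypothesis card_cap : forall j, (j < l2)%N -> #|cap j| = s.
Hypothesis card_tmpl : forall j, (j < l2)%N -> #|tmpl j| = r.
Hypothesis tmpl_cap : forall j, (j < l2)%N -> tmpl j \subset cap j.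
Hypothesis tmpl_sub : forall j, (j < l2)%N -> tmpl j \subset ~: C.
Hypothesis edgesE : forall e, e \in E ->
  (exists j, e = C :|: ray j) \/ (exists2 j, (j < l2)%N & e = cap j).
Local Notation v := #|~: C|.
Hypothesis rv : (r <= v)%N.

Variables (n b t : nat).
Hypothesis part_disj : forall x y z, z \in part n x -> z \in part n y -> x = y.
Hypothesis part_center : forall x, x \in C -> #|part n x| = 1%N.
Hypothesis part_card : forall x, x \in ~: C -> #|part n x| = b.
Hypothesis b_gt0 : (0 < b)%N.
Variable x0 : rsets n r.

Local Notation emb := (emb (part n)).
Local Notation N := #|{: rsets n r}|.
Local Notation Pr := (@Pr F 'I_t (rsets n r)).
Local Notation Ex := (@Ex F 'I_t (rsets n r)).
Local Notation q w := (hitp F N w).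

Lemma rsets_gt0 : (0 < N)%N.
Proof. by apply/card_gt0P; exists x0. Qed.

Definition inner (I : {set 'I_k}) : nat := #|[set j : 'I_l1 | ray j \subset I]|.

(** The center and the vertices of [I] are forced; each of the remaining [v - #|I|] vertices has [b]
    possible images. *)
Lemma card_emb_pinned (I : {set 'I_k}) phi : I \subset ~: C ->
  (#|[set psi in emb | I \subset agree C phi psi]| <= b ^ (v - #|I|))%N.
Proof.
move=> IC.
pose P x : pred 'I_n := if x \in I then pred1 (phi x) else mem (part n x).
apply: (@leq_trans #|family P|).
  apply/subset_leq_card/subsetP => psi; rewrite inE => /andP[/embP hp /subsetP ag].
  apply/familyP => x; rewrite /P; case: ifP => [xI|_]; last exact: hp.
  by have := ag x xI; rewrite !inE eq_sym => /andP[].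
rewrite card_family foldrE big_map big_enum /=.
rewrite (eq_bigr (fun x => if x \in ~: C :\: I then b else 1%N)); last first.
  move=> x _; rewrite /P !inE; case: (boolP (x \in I)) => [xI|_] /=; first by rewrite card1.
  by case: (boolP (x \in C)) => [/part_center //|xC]; rewrite -(part_card (x := x)) // inE.
by rewrite -big_mkcond prod_nat_const cardsD (setIidPr IC).
Qed.

Lemma card_emb : #|emb| = (b ^ v)%N.
Proof.
rewrite -(_ : #|family (fun x => mem (part n x))| = #|emb|).
  rewrite card_family foldrE big_map big_enum /=.
  rewrite (eq_bigr (fun x => if x \in ~: C then b else 1%N)).
    by rewrite -big_mkcond prod_nat_const.
  move=> x _; case: ifP => [/part_card //|]; rewrite inE => /negbFE.
  exact: part_center.
apply: eq_card => phi; rewrite [RHS]inE; exact/familyP/forallP.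
Qed.

(** Bounds an expected number of pairs of flowers, sorted by the set [I] on which they agree: such a
    pair makes [2 * l1 - inner I] distinct ray requests. *)
Definition overlap (D : pred {set 'I_k}) (w : nat) : F :=
  \sum_(I : {set 'I_k} | (I \subset ~: C) && D I)
     (b ^ v * b ^ (v - #|I|))%:R * q w ^+ (2 * l1 - inner I).

Lemma sum_emb_pairs (D : pred {set 'I_k}) w :
  \sum_(phi in emb) \sum_(psi in emb | D (agree C phi psi))
     q w ^+ (2 * l1 - inner (agree C phi psi)) <= overlap D w.
Proof.
have q0 m : 0 <= q w ^+ m by rewrite exprn_ge0 ?hitp_ge0 ?rsets_gt0.
apply: le_trans (_ : \sum_(phi in emb) \sum_(I : {set 'I_k} | (I \subset ~: C) && D I)
     (b ^ (v - #|I|))%:R * q w ^+ (2 * l1 - inner I) <= _); last first.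
  rewrite sumr_const card_emb -[leLHS]mulr_natl mulr_sumr.
  by apply: ler_sum => I _; rewrite natrM mulrA.
apply: ler_sum => phi _.
rewrite (partition_big (agree C phi) (fun I => (I \subset ~: C) && D I)) /=; last first.
  by move=> psi /andP[_ ->]; rewrite andbT; apply/subsetP => x; rewrite inE => /andP[].
apply: ler_sum => I /andP[IC _].
rewrite (eq_bigr (fun=> q w ^+ (2 * l1 - inner I))); last by move=> psi /andP[_ /eqP ->].
rewrite sumr_const -[leLHS]mulr_natl ler_wpM2r // ler_nat.
apply: leq_trans (card_emb_pinned phi IC); apply/subset_leq_card/subsetP => psi.
by rewrite unfold_in => /andP[/andP[hp _] /eqP <-]; rewrite inE hp /=.
Qed.

Definition ray_window w (j : 'I_l1) : {set 'I_t} := window t (fun i : 'I_w => j * w + i)%N.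
Definition ray_target (phi : {ffun 'I_k -> 'I_n}) (j : 'I_l1) : rsets n r :=
  insubd x0 (phi @: ray j).

(** * First phase: many flowers appear *)

Section PhaseOne.
Variable w : nat.
Hypothesis wt : (l1 * w <= t)%N.

Lemma ray_window_lt (j : 'I_l1) (i : 'I_w) : (j * w + i < t)%N.
Proof. exact: leq_trans (block_lt j i) wt. Qed.

Lemma card_ray_window j : #|ray_window w j| = w.
Proof.
apply: card_window => [y|y y' /addnI/val_inj //]; exact: ray_window_lt.
Qed.

Lemma ray_window_disj j j' : j != j' -> [disjoint ray_window w j & ray_window w j'].
Proof.
apply: contraNT => /pred0Pn[i /=]; rewrite !inE => /andP[/existsP[y /eqP ->]].
move=> /existsP[y' /eqP/(congr1 (divn^~ w))].
by rewrite !divnMDl ?(leq_ltn_trans _ (ltn_ord y)) // !divn_small // !addn0 => /val_inj ->.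
Qed.

Lemma card_emb_ray phi j : phi \in emb -> #|phi @: ray j| = r.
Proof. by move=> hp; rewrite card_imset //; apply: emb_inj hp. Qed.

Lemma agreement_inner phi psi : phi \in emb -> psi \in emb ->
  agreement ray_target phi psi = inner (agree C phi psi).
Proof.
move=> hp hq; apply: eq_card => j; rewrite !inE -(emb_imset_agree part_disj) //.
apply/eqP/eqP => [|e]; last by rewrite /ray_target e.
by apply: insubd_inj; rewrite card_emb_ray.
Qed.

Definition rays_hit (u : {ffun 'I_t -> rsets n r}) : nat :=
  num_hit emb (ray_window w) ray_target u.

Lemma Ex_rays_hit : Ex (fun u => (rays_hit u)%:R) = (b ^ v)%:R * q w ^+ l1.
Proof.
by rewrite (Ex_num_hit F rsets_gt0 _ _ card_ray_window ray_window_disj) card_emb card_ord.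
Qed.

Lemma var_rays_hit : Ex (fun u => (rays_hit u)%:R ^+ 2) - Ex (fun u => (rays_hit u)%:R) ^+ 2
  <= overlap (fun I => 0 < inner I)%N w.
Proof.
apply: le_trans (var_num_hit F rsets_gt0 _ _ card_ray_window ray_window_disj) _.
apply: le_trans (sum_emb_pairs _ w); rewrite card_ord.
apply: ler_sum => phi hp; rewrite le_eqVlt; apply/orP; left; apply/eqP.
apply: eq_big => [psi|psi /andP[hq _]]; last by rewrite agreement_inner.
by case: (boolP (psi \in emb)) => //= hq; rewrite agreement_inner.
Qed.

(** Dividing the variance bound by the squared mean leaves, for each [I], the inverse of
    [b ^ #|I| * q ^ inner I], which is the order of the expected number of partial flowers on
    [I]. *)
Lemma Pr_rays_few : 0 < q w ->
  Pr (fun u => (rays_hit u)%:R < (b ^ v)%:R * q w ^+ l1 / 2%:R)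
  <= 4%:R * \sum_(I : {set 'I_k} | (I \subset ~: C) && (0 < inner I)%N)
        (b%:R ^+ #|I| * q w ^+ inner I)^-1.
Proof.
move=> q0; have b0 : 0 < b%:R :> F by rewrite ltr0n.
have M0 : 0 < (b ^ v)%:R * q w ^+ l1 by rewrite mulr_gt0 ?exprn_gt0 ?natrX // exprn_gt0.
rewrite -Ex_rays_hit; apply: le_trans (chebyshev rsets_gt0 _) _; first by rewrite Ex_rays_hit.
rewrite -mulrA ler_wpM2l ?ler0n // ler_pdivrMr; last by rewrite Ex_rays_hit exprn_gt0.
apply: le_trans var_rays_hit _; rewrite Ex_rays_hit mulr_suml; apply: ler_sum => I /andP[IC _].
rewrite le_eqVlt; apply/orP; left; apply/eqP.
have cI : (#|I| <= v)%N by apply: subset_leq_card.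
have iI : (inner I <= l1)%N by rewrite -[leqRHS]card_ord max_card.
rewrite -expnD !natrX exprMn -!exprM.
have -> : b%:R ^+ (v + (v - #|I|)) = b%:R ^+ (v * 2) / b%:R ^+ #|I| :> F.
  by rewrite -[(v * 2)%N](_ : (v + (v - #|I|)) + #|I| = _)%N ?exprD ?mulfK ?expf_neq0 ?gt_eqF //; lia.
have -> : q w ^+ (2 * l1 - inner I) = q w ^+ (l1 * 2) / q w ^+ inner I.
  by rewrite -[(l1 * 2)%N](_ : (2 * l1 - inner I) + inner I = _)%N ?exprD ?mulfK ?expf_neq0 ?gt_eqF //; lia.
by rewrite invfM; field; rewrite !expf_neq0 ?gt_eqF.
Qed.

Lemma all_ray_hit phi u : phi \in emb ->
  all_hit (ray_window w) ray_target phi u =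
  [forall j : 'I_l1, [exists i : 'I_w, nth set0 (sample u) (j * w + i) == phi @: ray j]].
Proof.
move=> hp; apply: eq_forallb => j; rewrite hit_window ?card_emb_ray // => i.
exact: ray_window_lt.
Qed.
End PhaseOne.

Local Notation star := (star_strategy r s l2 C ray cap tmpl part w1).
Local Notation copy u := (has_copy E (process_edges star (sample u))).

Lemma Pr_no_copy_capless w : l2 = 0 -> (l1 * w <= t)%N -> 0 < q w ->
  Pr (fun u => ~~ copy u)
  <= 4%:R * \sum_(I : {set 'I_k} | (I \subset ~: C) && (0 < inner I)%N)
        (b%:R ^+ #|I| * q w ^+ inner I)^-1.
Proof.
move=> l20 wt q0; apply: le_trans (Pr_rays_few wt q0); apply: (Pr_le _ rsets_gt0) => u.
apply: contraNT; rewrite -leNgt => le.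
have : (0 < rays_hit w u)%N.
  rewrite -(ltr0n F); apply: lt_le_trans le.
  by rewrite !mulr_gt0 ?invr_gt0 ?ltr0n ?expn_gt0 ?b_gt0 // exprn_gt0.
rewrite card_gt0 => /set0Pn[phi]; rewrite inE => /andP[hp].
rewrite all_ray_hit // => /forallP h.
apply: (has_copy_emb r_gt0 rs cC ray_sub card_ray card_cap card_tmpl tmpl_cap tmpl_sub
  edgesE part_disj part_center hp) => [j|j]; last by rewrite l20.
have /existsP[i /eqP eU] := h j; exists (j * w + i)%N; rewrite size_sample l20 eqxx.
by split=> //; apply: ray_window_lt.
Qed.

(** * Second phase: completing selected flowers by their caps *)

Section PhaseTwo.
Variable w2 : nat.
Local Notation T1 := (l1 * w1 n)%N.
Hypothesis wt : (T1 + l2 * w2 <= t)%N.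
Local Notation alive := (alive ray part w1).
Local Notation clash := (@conflict k r C n).

Lemma T1_le : (T1 <= t)%N.
Proof. exact: leq_trans (leq_addr _ _) wt. Qed.

Lemma alive_sample u :
  alive (sample u) = [set phi in emb | all_hit (ray_window (w1 n)) ray_target phi u].
Proof.
apply/setP => phi; rewrite [LHS]inE [RHS]inE; apply: andb_id2l => hp.
by rewrite all_ray_hit // T1_le.
Qed.

Lemma card_alive u : #|alive (sample u)| = rays_hit (w1 n) u.
Proof. by rewrite alive_sample. Qed.

Definition conflicts (X : {set {ffun 'I_k -> 'I_n}}) : nat :=
  \sum_(phi in X) \sum_(psi in X | clash phi psi) 1.

Lemma Ex_conflicts : Ex (fun u => (conflicts (alive (sample u)))%:R)
  <= overlap (fun I => r <= #|I|)%N (w1 n).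
Proof.
apply: le_trans (sum_emb_pairs _ _).
have := Ex_num_hit2 F rsets_gt0 emb ray_target (card_ray_window T1_le)
  (@ray_window_disj (w1 n)) clash.
rewrite card_ord => le; apply: le_trans (le_trans _ le) _.
  rewrite le_eqVlt; apply/orP; left; apply/eqP/eq_Ex => u.
  rewrite natr_sum big_mkcond [RHS]big_mkcond; apply: eq_bigr => phi _ /=.
  rewrite alive_sample inE; case: (phi \in emb) => //=.
  rewrite natr_sum big_mkcond [RHS]big_mkcond /=.
  case: (boolP (all_hit _ _ phi u)) => _ /=.
    by apply: eq_bigr => psi _; rewrite inE; case: (psi \in emb) => //=;
       case: (all_hit _ _ psi u); case: (clash phi psi).
  by rewrite big1 // => psi _; case: ifP.
apply: ler_sum => phi hp; rewrite le_eqVlt; apply/orP; left; apply/eqP.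
by apply: eq_bigr => psi /andP[hq _]; rewrite agreement_inner.
Qed.

(** These times have the residue that [star_target] reads as [j]; interleaving keeps the windows
    disjoint. *)
Definition cap_window (j : 'I_l2) : {set 'I_t} :=
  window t (fun i : 'I_w2 => T1 + j + l2 * i)%N.
Definition cap_target (phi : {ffun 'I_k -> 'I_n}) (j : 'I_l2) : rsets n r :=
  insubd x0 (phi @: tmpl j).

Lemma cap_window_lt (j : 'I_l2) (i : 'I_w2) : (T1 + j + l2 * i < t)%N.
Proof. by have := ltn_ord i; have := ltn_ord j; nia. Qed.

Lemma card_cap_window j : #|cap_window j| = w2.
Proof.
apply: card_window => [y|y y']; first exact: cap_window_lt.
move=> /addnI/eqP; rewrite eqn_mul2l => /orP[/eqP l20|/eqP/val_inj //].
by have := ltn_ord j; lia.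
Qed.

Lemma cap_window_disj j j' : j != j' -> [disjoint cap_window j & cap_window j'].
Proof.
apply: contraNT => /pred0Pn[i /=]; rewrite !inE => /andP[/existsP[y /eqP ->]].
move=> /existsP[y']; rewrite -!addnA eqn_add2l => /eqP/(congr1 (modn^~ l2)).
by rewrite ![(_ + l2 * _)%N]addnC ![(l2 * _)%N]mulnC !modnMDl !modn_small // => /val_inj ->.
Qed.

Lemma card_emb_tmpl phi (j : 'I_l2) : phi \in emb -> #|phi @: tmpl j| = r.
Proof. by move=> hp; rewrite card_imset ?card_tmpl //; apply: emb_inj hp. Qed.

Definition caps_missed (X : {set {ffun 'I_k -> 'I_n}}) (u : {ffun 'I_t -> rsets n r}) :=
  num_hit X cap_window cap_target u == 0%N.

(** Distinct members of [X] never ask for the same [r]-set in the same window, since that would be a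
    conflict. Only the diagonal survives in the variance, which is thus at most the mean. *)
Lemma Pr_caps_missed (X : {set {ffun 'I_k -> 'I_n}}) :
  X \subset emb -> independent clash X -> (0 < #|X|)%N -> 0 < q w2 ->
  Pr (caps_missed X) <= 4%:R / (#|X|%:R * q w2 ^+ l2).
Proof.
move=> /subsetP Xemb /independentP indX X0 q0.
have e := Ex_num_hit F rsets_gt0 X cap_target card_cap_window cap_window_disj.
rewrite card_ord in e.
have m0 : 0 < #|X|%:R * q w2 ^+ l2 by rewrite mulr_gt0 ?ltr0n ?exprn_gt0.
apply: le_trans (_ : Pr (fun u => (num_hit X cap_window cap_target u)%:R <
    Ex (fun u => (num_hit X cap_window cap_target u)%:R) / 2%:R) <= _).
  by apply: (Pr_le _ rsets_gt0) => u /eqP ->; rewrite e divr_gt0 ?ltr0n.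
apply: le_trans (chebyshev rsets_gt0 _) _; first by rewrite e.
rewrite -mulrA ler_wpM2l ?ler0n // ler_pdivrMr; last by rewrite e exprn_gt0.
apply: le_trans (var_num_hit F rsets_gt0 _ _ card_cap_window cap_window_disj) _.
rewrite e expr2 mulKf ?gt_eqF // card_ord mulr_natl -sumr_const.
apply: ler_sum => phi hp.
apply: le_trans (_ : \sum_(psi | psi == phi) q w2 ^+ l2 <= _); last by rewrite big_pred1_eq.
rewrite big_mkcond [leRHS]big_mkcond; apply: ler_sum => psi _; case: ifP => [/andP[hq]|_].
  rewrite card_gt0 => /set0Pn[j]; rewrite inE => /eqP /insubd_inj ej.
  have -> : psi = phi.
    apply: indX => //; rewrite /conflict -(card_tmpl (ltn_ord j)).
    apply: subset_leq_card; rewrite -(emb_imset_agree part_disj) ?Xemb ?tmpl_sub //.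
    by apply/eqP; rewrite ej ?card_emb_tmpl ?Xemb.
  rewrite eqxx (_ : 2 * l2 - _ = l2)%N // /agreement.
  rewrite (_ : [set _ | _] = setT) ?cardsT ?card_ord; first by lia.
  by apply/setP => i; rewrite !inE eqxx.
by case: ifP => // _; rewrite exprn_ge0 ?ltW.
Qed.

(** [M] is the mean number of flowers. The three terms bound the events of finding fewer than
    [M / 2] flowers, of having at least [L * M] conflicting pairs, and of completing no member of a
    large selected family. *)
Lemma Pr_no_copy (L M : F) : 0 < L -> (0 < l2)%N -> 0 < q (w1 n) -> 0 < q w2 ->
  M = (b ^ v)%:R * q (w1 n) ^+ l1 ->
  Pr (fun u => ~~ copy u)
  <= 4%:R * \sum_(I : {set 'I_k} | (I \subset ~: C) && (0 < inner I)%N)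
        (b%:R ^+ #|I| * q (w1 n) ^+ inner I)^-1
     + overlap (fun I => r <= #|I|)%N (w1 n) / (L * M)
     + 64%:R * L / (M * q w2 ^+ l2).
Proof.
move=> L0 l20 q10 q20 eM.
have M0 : 0 < M by rewrite eM mulr_gt0 ?exprn_gt0 // ltr0n expn_gt0 b_gt0.
pose f (u : {ffun 'I_t -> rsets n r}) := max_indep clash (alive (sample u)).
(* With at least [M / 2] flowers and fewer than [L * M] conflicts, [max_indep_lb] gives
   [M^2 / 4 <= 4 * L * M * #|X|], hence the 16. Combined with the 4 of [Pr_caps_missed] it becomes
   the final 64. *)
pose good (X : {set {ffun 'I_k -> 'I_n}}) :=
  [&& X \subset emb, independent clash X & M / (16%:R * L) <= #|X|%:R].
apply: le_trans (_ : Pr (fun u => ((rays_hit (w1 n) u)%:R < M / 2%:R) ||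
  (L * M <= (conflicts (alive (sample u)))%:R) || (good (f u) && caps_missed (f u) u)) <= _).
  apply: (Pr_le _ rsets_gt0) => u; apply: contraNT.
  rewrite !negb_or -leNgt -ltNge => /andP[/andP[many few]].
  have [sub ind _] := max_indepP clash (alive (sample u)).
  have subE : f u \subset emb.
    by apply: subset_trans sub _; apply/subsetP => phi; rewrite inE => /andP[].
  have gd : good (f u).
    rewrite /good subE ind /= ler_pdivrMr ?mulr_gt0 ?ltr0n //.
    have refl : reflexive clash.
      move=> phi; rewrite /conflict (_ : agree C phi phi = ~: C) //.
      by apply/setP => x; rewrite inE eqxx andbT.
    have sym : symmetric clash.
      move=> phi psi; rewrite /conflict; congr (_ <= #|pred_of_set _|)%N.
      by apply/setP => x; rewrite !inE eq_sym.
    have := max_indep_lb refl sym (alive (sample u)).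
    rewrite -/(conflicts _) -/(f u) card_alive -(ler_nat F) natrX !natrM.
    move: (rays_hit (w1 n) u)%:R (conflicts _)%:R many few (ler0n F #|f u|) => S B.
    move: (#|f u|%:R : F) => X; move=> h1 h2 X0 h3.
    have : (M / 2%:R) ^+ 2 <= S ^+ 2 by rewrite lerXn2r ?nnegrE; lra.
    have : 4%:R * B * X <= 4%:R * (L * M) * X by rewrite ler_wpM2r //; lra.
    by move=> h4 h5; rewrite -(ler_pM2l M0); lra.
  rewrite gd /= -lt0n card_gt0 => /set0Pn[phi]; rewrite inE => /andP[hF /forallP hcaps].
  have hp := subsetP subE _ hF.
  have := subsetP sub _ hF; rewrite alive_sample inE hp all_ray_hit ?T1_le //= => /forallP hrays.
  apply: (has_copy_emb r_gt0 rs cC ray_sub card_ray card_cap card_tmpl tmpl_cap tmpl_sub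
    edgesE part_disj part_center hp) => [j|j jl].
    have /existsP[i /eqP eU] := hrays j; exists (j * w1 n + i)%N; rewrite size_sample.
    split=> //; first exact: (ray_window_lt T1_le).
    by rewrite block_lt orbT.
  split=> //; have := hcaps (Ordinal jl).
  rewrite hit_window ?card_emb_tmpl //; last exact: cap_window_lt.
  move=> /existsP[i /eqP eU]; exists i; rewrite size_sample; split=> //.
  exact: (cap_window_lt (Ordinal jl) i).
apply: le_trans (Pr_union _ rsets_gt0 _ _) _; apply: lerD.
  apply: le_trans (Pr_union _ rsets_gt0 _ _) _; apply: lerD; first by rewrite eM; apply: Pr_rays_few T1_le q10.
  apply: le_trans (markov rsets_gt0 (mulr_gt0 L0 M0) (fun u => ler0n F _)) _.
  by rewrite ler_wpM2r ?Ex_conflicts // invr_ge0 mulr_ge0 ?ltW.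
(* The selected family is determined before time [T1], and the cap windows start at [T1]. *)
apply: (@Pr_cond _ _ _ _ [set i : 'I_t | (i < T1)%N] _ f good caps_missed rsets_gt0).
- by rewrite divr_ge0 ?mulr_ge0 ?ler0n ?ltW // exprn_gt0.
- move=> u u' e; rewrite /f (_ : alive (sample u) = alive (sample u')) //.
  rewrite !alive_sample; apply/setP => phi; rewrite [LHS]inE [RHS]inE.
  rewrite (@eq_all_hit _ _ _ _ _ _ phi u u') // => j i.
  by rewrite inE => /existsP[y /eqP iy]; apply: e; rewrite inE iy; apply: block_lt.
- move=> X u u' e; rewrite /caps_missed (@eq_num_hit _ _ _ _ _ _ _ u u') // => j i.
  rewrite inE => /existsP[y /eqP iy]; apply: e.
  by rewrite !inE iy -leqNgt -addnA leq_addr.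
move=> X /and3P[sub ind big].
have X0 : (0 < #|X|)%N by rewrite -(ltr0n F); apply: lt_le_trans big; rewrite divr_gt0 ?mulr_gt0 ?ltr0n.
apply: le_trans (Pr_caps_missed sub ind X0 q20) _.
have p0 : 0 < q w2 ^+ l2 by rewrite exprn_gt0.
have e : 64%:R * L / (M * q w2 ^+ l2) = 4%:R / (M / (16%:R * L) * q w2 ^+ l2).
  by field; rewrite !gt_eqF.
have M16 : 0 < M / (16%:R * L) by rewrite divr_gt0 ?mulr_gt0 ?ltr0n.
rewrite e ler_wpM2l ?ler0n // lef_pV2 ?posrE; first by rewrite ler_pM2r.
  by rewrite mulr_gt0 ?ltr0n.
by rewrite mulr_gt0.
Qed.
End PhaseTwo.
End FixedN.

(** * Asymptotics of the failure probability *)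

Lemma bin_le_exp n r : ('C(n, r) <= n ^ r)%N.
Proof.
apply: leq_trans (_ : n ^_ r <= _)%N; first by rewrite -bin_ffact leq_pmulr ?fact_gt0.
by elim: r => // r IH; rewrite ffactnSr expnSr leq_mul // leq_subr.
Qed.

(** Each factor of the falling factorial is at least [n / 2]. *)
Lemma exp_le_bin n r : (2 * r <= n)%N -> (n ^ r <= 2 ^ r * r`! * 'C(n, r))%N.
Proof.
move=> rn; rewrite -mulnA [(r`! * _)%N]mulnC bin_ffact.
have: forall j, (j <= r)%N -> (n ^ j <= 2 ^ j * n ^_ j)%N; last exact.
elim=> // j IH jr; rewrite ffactnSr !expnSr mulnACA leq_mul ?IH //; first exact: ltnW.
by lia.
Qed.

(** * Exponent inequalities for a set of [i] flower vertices containing [e] rays *)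

Section Exponents.
Variables (r v l1 l2 i e : nat).
Hypotheses (rv : (r < v)%N) (l1_gt1 : (1 < l1)%N) (el1 : (e <= l1)%N).
Hypothesis cond : ((l1 + l2) * (v - r) <= v * (l1 - 1))%N.
Hypotheses (ri : (r <= i)%N) (iv : (i <= v)%N).
Hypothesis dens : (e * (v - r) <= (l1 - 1) * (i - r) + (v - r))%N.

(** Equivalent to [n^(v-i) x^(l1-e) <= 1]: a flower has boundedly many expected partners overlapping
    it in this way. Here [dens] gives [(l1 - 1) * (v - i) <= (l1 - e) * (v - r)], and [cond] does
    the rest. *)
Lemma exponent_conflict : ((l1 + l2) * (v - i) <= v * (l1 - e))%N.
Proof.
have d0 : (0 < v - r)%N by lia.
rewrite -(leq_pmul2r d0); apply: (@leq_trans (v * (l1 - 1) * (v - i))).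
  by rewrite mulnAC leq_mul2r cond orbT.
rewrite -!mulnA leq_mul2l mulnBl; apply/orP; right.
have -> : (v - i = (v - r) - (i - r))%N by lia.
have : (i - r <= v - r)%N by lia.
move: dens; have -> : (l1 = (l1 - 1).+1)%N by lia.
rewrite !subn1 /=; move: (v - r)%N (i - r)%N (l1.-1) => d j a; nia.
Qed.

(** Equivalent to [n^i x^(e+l2) >= 1]: partial flowers are at least as numerous as [x^(-l2)]. *)
Lemma exponent_variance : (v * (e + l2) <= i * (l1 + l2))%N.
Proof.
have d0 : (0 < v - r)%N by lia.
rewrite -(leq_pmul2r d0).
have [j [c [ij vc]]] : exists j c, (i = r + j)%N /\ (v = r + j + c)%N.
  by exists (i - r)%N, (v - i)%N; lia.
have [a la] : exists a, (l1 = a.+1)%N by exists (l1.-1); lia.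
have e1 : (v - r = j + c)%N by lia.
have e2 : (i - r = j)%N by lia.
have e3 : (l1 - 1 = a)%N by lia.
(* The goal is the sum of [v - i] times [cond] and [v] times [dens]. *)
have := leq_mul (leqnn c) cond; have := leq_mul (leqnn v) dens.
by rewrite e1 e2 e3 ij vc la; lia.
Qed.
End Exponents.

(** * Comparing monomials in [n] and [y = n^(-v/m)] *)

Section Scale.
Variables (F : realFieldType) (m v n : nat) (y : F).
Hypotheses (m_gt0 : (0 < m)%N) (n_gt0 : (0 < n)%N) (y_gt0 : 0 < y).
Hypothesis yE : y ^+ m * n%:R ^+ v = 1.

Lemma scale_ge0 i e : 0 <= n%:R ^+ i * y ^+ e.
Proof. by rewrite mulr_ge0 ?exprn_ge0 ?ler0n // ltW. Qed.

Let n1 : 1 <= n%:R :> F. Proof. by rewrite ler1n. Qed.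

(** Raising to the power [m] turns fractional powers of [n] into natural ones, so the comparisons
    below stay algebraic. *)
Lemma scale_exp i e : (v * e <= i * m)%N -> (n%:R ^+ i * y ^+ e) ^+ m = n%:R ^+ (i * m - v * e).
Proof.
move=> le; rewrite exprMn -!exprM -{1}(subnK le) exprD [(e * m)%N]mulnC [(v * e)%N in X in _ * X * _]mulnC.
rewrite -mulrA -[RHS]mulr1; congr (_ * _).
by rewrite [(e * v)%N]mulnC !exprM -exprMn mulrC yE expr1n.
Qed.

Lemma scale_ge1 i e : (v * e <= i * m)%N -> 1 <= n%:R ^+ i * y ^+ e.
Proof.
move=> le; have := scale_exp le => eq.
rewrite -(@ler_pXn2r _ m) // ?nnegrE ?ler01 ?scale_ge0 //.
by rewrite eq expr1n exprn_ege1.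
Qed.

(** A strict exponent inequality leaves at least one factor [n] in the [m]-th power, so the monomial
    exceeds any constant eventually. *)
Lemma scale_ge G i e : 0 <= G -> G ^+ m <= n%:R -> (v * e < i * m)%N -> G <= n%:R ^+ i * y ^+ e.
Proof.
move=> G0 Gn lt; have := scale_exp (ltnW lt) => eq.
rewrite -(@ler_pXn2r _ m) // ?nnegrE ?scale_ge0 //.
by rewrite eq (le_trans Gn) // ler_eXnr // subn_gt0.
Qed.

Lemma scale_le1 i e : (i * m <= v * e)%N -> n%:R ^+ i * y ^+ e <= 1.
Proof.
move=> le; rewrite -(@ler_pXn2r _ m) // ?nnegrE ?ler01 ?scale_ge0 //.
rewrite exprMn -!exprM expr1n [(e * m)%N]mulnC [y ^+ _]exprM.
have -> : y ^+ m = (n%:R ^+ v)^-1.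
  by apply: (mulIf (_ : n%:R ^+ v != 0)); rewrite ?yE ?mulVf // expf_neq0 // pnatr_eq0 -lt0n.
by rewrite exprVn -exprM ler_pdivrMr ?exprn_gt0 ?ltr0n // mul1r ler_weXn2l.
Qed.

Lemma scale_small d : 0 < d -> (0 < v)%N -> (d ^-1) ^+ m <= n%:R -> y <= d.
Proof.
move=> d0 v0 dn; rewrite leNgt; apply/negP => dy.
have : d ^+ m * n%:R ^+ v < y ^+ m * n%:R ^+ v.
  by rewrite ltr_pM2r ?exprn_gt0 ?ltr0n // ltr_pXn2r ?nnegrE ?ltW.
rewrite yE ltNge; apply/negP; rewrite negbK.
apply: le_trans (_ : d ^+ m * n%:R <= _); last by rewrite ler_pM2l ?exprn_gt0 // ler_eXnr.
by rewrite -ler_pdivrMl ?exprn_gt0 // mulr1 -exprVn.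
Qed.
End Scale.

(** * The concrete blocks *)

Section Blocks.
Variables (k : nat) (C : {set 'I_k}).

(** [k] consecutive intervals of length [n %/ k]; a central vertex keeps only the first point of its
    interval. *)
Definition block n (x : 'I_k) : {set 'I_n} :=
  window n (fun i : 'I_(if x \in C then 1%N else (n %/ k)%N) => x * (n %/ k) + i)%N.

Variable n : nat.
Hypothesis b_gt0 : (0 < n %/ k)%N.

Lemma block_idx (x : 'I_k) (i : 'I_(if x \in C then 1%N else (n %/ k)%N)) : (i < n %/ k)%N.
Proof. by apply: leq_trans (ltn_ord i) _; case: ifP. Qed.

Lemma card_block x : #|block n x| = (if x \in C then 1 else n %/ k)%N.
Proof.
apply: card_window => [i|i i' /addnI/val_inj //].
have := block_lt x (Ordinal (block_idx i)) => /= h; apply: leq_trans h _.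
by rewrite mulnC leq_divM.
Qed.

Lemma block_disj x y z : z \in block n x -> z \in block n y -> x = y.
Proof.
rewrite !inE => /existsP[i /eqP ->] /existsP[i' /eqP/(congr1 (divn^~ (n %/ k)%N))].
by rewrite !divnMDl // !divn_small ?block_idx // !addn0 => /val_inj.
Qed.
End Blocks.

(** * Hitting probabilities for windows of length of order [n^r y] *)

Section Rates.
Variables (F : realFieldType) (r n : nat) (y : F).
Hypotheses (rn : (2 * r <= n)%N) (y_gt0 : 0 < y).
Definition bin_cst : F := (2 ^ r * r`!)%:R.
Local Notation N := #|{: rsets n r}|.
Local Notation q w := (hitp F N w).

Lemma bin_cst_gt0 : 0 < bin_cst.
Proof. by rewrite ltr0n muln_gt0 expn_gt0 fact_gt0. Qed.

Lemma rsets_card_gt0 : (0 < N)%N.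
Proof. by rewrite card_rsets bin_gt0 (leq_trans _ rn) // leq_pmull. Qed.

Lemma rsets_card_le : N%:R <= n%:R ^+ r :> F.
Proof. by rewrite card_rsets -natrX ler_nat bin_le_exp. Qed.

Lemma rsets_card_ge : n%:R ^+ r <= bin_cst * N%:R.
Proof. by rewrite card_rsets -natrX -natrM ler_nat exp_le_bin. Qed.

Lemma window_le_card (c : F) w : c * bin_cst * y <= 1 -> 0 <= c ->
  w%:R <= c * (n%:R ^+ r * y) -> (w <= N)%N.
Proof.
move=> c1 c0 le; rewrite -(ler_nat F); apply: le_trans le _.
apply: le_trans (_ : c * (bin_cst * N%:R * y) <= _).
  by rewrite ler_wpM2l // ler_wpM2r ?rsets_card_ge // ltW.
rewrite (_ : c * _ = (c * bin_cst * y) * N%:R); last by ring.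
by rewrite -[leRHS]mul1r ler_wpM2r.
Qed.

Lemma hitp_rate_ge (c : F) w : 0 <= c -> c * (n%:R ^+ r * y) <= w%:R -> (w <= N)%N ->
  c * y / 2%:R <= q w.
Proof.
move=> c0 le wN; apply: le_trans (hitp_ge F rsets_card_gt0 wN).
have N0 : 0 < N%:R :> F by rewrite ltr0n rsets_card_gt0.
rewrite ler_wpM2r ?invr_ge0 ?ler0n // ler_pdivlMr //; apply: le_trans le.
by rewrite -mulrA ler_wpM2l // mulrC ler_wpM2r ?rsets_card_le // ltW.
Qed.

Lemma hitp_rate_le (c : F) w : 0 <= c -> w%:R <= c * (n%:R ^+ r * y) ->
  q w <= c * bin_cst * y.
Proof.
move=> c0 le; apply: le_trans (hitp_le F w rsets_card_gt0) _.
have N0 : 0 < N%:R :> F by rewrite ltr0n rsets_card_gt0.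
rewrite ler_pdivrMr //; apply: le_trans le _.
rewrite (_ : _ * N%:R = c * (bin_cst * N%:R * y)); last by ring.
by rewrite ler_wpM2l // ler_wpM2r ?rsets_card_ge // ltW.
Qed.
End Rates.

(** * Choice of constants and window lengths *)

Section Asymptotics.
Variable F : archiRealFieldType.
Variables (k r s l1 l2 : nat) (E : {set {set 'I_k}}) (C : {set 'I_k}).
Variables (ray : 'I_l1 -> {set 'I_k}) (cap tmpl : nat -> {set 'I_k}).
Hypotheses (r_gt0 : (0 < r)%N) (rs : (r < s)%N).
Hypothesis cC : #|C| = (s - r)%N.
Hypothesis ray_sub : forall j, ray j \subset ~: C.
Hypothesis card_ray : forall j, #|ray j| = r.
Hypothesis card_cap : forall j, (j < l2)%N -> #|cap j| = s.
Hypothesis card_tmpl : forall j, (j < l2)%N -> #|tmpl j| = r.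
Hypothesis tmpl_cap : forall j, (j < l2)%N -> tmpl j \subset cap j.
Hypothesis tmpl_sub : forall j, (j < l2)%N -> tmpl j \subset ~: C.
Hypothesis edgesE : forall e, e \in E ->
  (exists j, e = C :|: ray j) \/ (exists2 j, (j < l2)%N & e = cap j).
Local Notation v := #|~: C|.
Local Notation m := (l1 + l2)%N.
Hypotheses (rv : (r < v)%N) (l1_gt1 : (1 < l1)%N).
Hypothesis cond : (m * (v - r) <= v * (l1 - 1))%N.
Hypothesis dens : forall I : {set 'I_k}, I \subset ~: C -> (r <= #|I|)%N ->
  (inner ray I * (v - r) <= (l1 - 1) * (#|I| - r) + (v - r))%N.
Variable y : nat -> F.
Hypothesis y_gt0 : forall n, (0 < n)%N -> 0 < y n.
Hypothesis yE : forall n, (0 < n)%N -> y n ^+ m * n%:R ^+ v = 1.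

Local Notation f n := (n%:R ^+ r * y n).
Definition phase_length n : nat := (Num.truncn (f n)).+1.
Local Notation star := (star_strategy r s l2 C ray cap tmpl (block C) phase_length).
Local Notation q n w := (hitp F #|{: rsets n r}| w).

Let m_gt0 : (0 < m)%N. Proof. by lia. Qed.
Let v_gt0 : (0 < v)%N. Proof. by lia. Qed.
Let k_gt0 : (0 < k)%N.
Proof. by apply: leq_trans v_gt0 _; rewrite -[leqRHS]card_ord max_card. Qed.

Lemma inner_le I : (inner ray I <= l1)%N.
Proof. by rewrite -[leqRHS]card_ord max_card. Qed.

Lemma inner_gt0 I : (0 < inner ray I)%N -> (r <= #|I|)%N.
Proof.
by rewrite card_gt0 => /set0Pn[j]; rewrite inE => /subset_leq_card; rewrite card_ray.
Qed.

(** [cond] implies [v <= r * m]. Rounding lengths up to integers therefore costs only a constant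
    factor. *)
Lemma rate_ge1 n : (0 < n)%N -> 1 <= f n.
Proof.
move=> n0; have := @scale_ge1 F m v n (y n) m_gt0 n0 (y_gt0 n0) (yE n0) r 1.
rewrite expr1; apply; move: cond.
have [a la] : exists a, (l1 = a.+1)%N by exists (l1.-1); lia.
have [d vd] : exists d, (v = r + d)%N by exists (v - r)%N; lia.
by rewrite vd la addKn subn1 /=; nia.
Qed.

Lemma round_rate (c : F) n : (0 < n)%N -> 1 <= c ->
  exists w : nat, c * f n <= w%:R <= (c + 1) * f n.
Proof.
move=> n0 c1; have f1 := rate_ge1 n0.
have cf : 0 <= c * f n by rewrite mulr_ge0; lra.
exists (Num.truncn (c * f n)).+1; have /andP[lo hi] := truncn_itv cf.
by rewrite ltW //= -natr1 mulrDl mul1r; lra.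
Qed.

Lemma phase_length_bounds n : (0 < n)%N ->
  f n <= (phase_length n)%:R /\ (phase_length n)%:R <= 2%:R * f n.
Proof.
move=> n0; have f1 := rate_ge1 n0.
have f0 : 0 <= f n by lra.
have /andP[lo hi] := truncn_itv f0; rewrite /phase_length ltW // -natr1; split=> //; lra.
Qed.

Lemma block_size_ge n : (k <= n)%N -> n%:R / (2 * k)%:R <= (n %/ k)%:R :> F.
Proof.
move=> kn; rewrite ler_pdivrMr ?ltr0n ?muln_gt0 // -natrM ler_nat.
have := ltn_ceil n k_gt0; have : (0 < n %/ k)%N by rewrite divn_gt0.
by rewrite mulSn; nia.
Qed.

(** Absorbs a loss [2 * k] per vertex, from [n %/ k >= n / (2 * k)], and a loss 2 per hit, from
    [hitp_ge]. *)
Definition cst : F := (2 * k)%:R ^+ v * 2%:R ^+ m.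

Lemma cst_gt0 : 0 < cst.
Proof. by rewrite mulr_gt0 ?exprn_gt0 ?ltr0n ?muln_gt0. Qed.

Lemma block_hit_ge n (c z : F) i e : (k <= n)%N -> (0 < n)%N -> 0 < c -> (i <= v)%N -> (e <= m)%N ->
  c * y n / 2%:R <= z -> c ^+ e * (n%:R ^+ i * y n ^+ e) <= cst * ((n %/ k)%:R ^+ i * z ^+ e).
Proof.
move=> kn n0 c0 iv em cz; have y0 := y_gt0 n0.
have k1 : 1 <= (2 * k)%:R :> F by rewrite ler1n; lia.
have k0 : 0 < (2 * k)%:R :> F by lra.
apply: le_trans (_ : (2 * k)%:R ^+ i * 2%:R ^+ e * ((n%:R / (2 * k)%:R) ^+ i * (c * y n / 2%:R) ^+ e) <= _).
  rewrite le_eqVlt; apply/orP; left; apply/eqP.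
  rewrite !expr_div_n !exprMn; field.
  by rewrite !expf_neq0 ?gt_eqF.
have h0 : 0 <= c * y n / 2%:R by rewrite !mulr_ge0 ?invr_ge0 ?ler0n ?ltW.
have n20 : 0 <= n%:R / (2 * k)%:R :> F by rewrite divr_ge0.
apply: ler_pM; rewrite ?mulr_ge0 ?exprn_ge0 ?ler0n //.
  apply: ler_pM; rewrite ?exprn_ge0 ?ler0n //; first exact: ler_weXn2l.
  by apply: ler_weXn2l; rewrite ?ler1n.
by apply: ler_pM; rewrite ?exprn_ge0 // lerXn2r ?nnegrE ?block_size_ge // (le_trans h0).
Qed.

Lemma variance_sum_le n (c z G : F) : (k <= n)%N -> (0 < n)%N -> 0 < c -> 0 < G ->
  c * y n / 2%:R <= z ->
  (forall I : {set 'I_k}, I \subset ~: C -> (0 < inner ray I)%N ->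
     G <= c ^+ inner ray I * (n%:R ^+ #|I| * y n ^+ inner ray I)) ->
  \sum_(I : {set 'I_k} | (I \subset ~: C) && (0 < inner ray I)%N)
     ((n %/ k)%:R ^+ #|I| * z ^+ inner ray I)^-1 <= (2 ^ k)%:R * cst / G.
Proof.
move=> kn n0 c0 G0 cz GI; have y0 := y_gt0 n0.
have z0 : 0 < z by apply: lt_le_trans cz; rewrite !mulr_gt0 ?invr_gt0 ?ltr0n.
have b0 : 0 < (n %/ k)%:R :> F by rewrite ltr0n divn_gt0.
apply: le_trans (_ : \sum_(I : {set 'I_k}) cst / G <= _).
  rewrite big_mkcond; apply: ler_sum => I _; case: ifP => [/andP[IC iI]|_]; last first.
    by rewrite divr_ge0 ?ltW ?cst_gt0.
  rewrite -div1r ler_pdivrMr ?mulr_gt0 ?exprn_gt0 // mulrAC ler_pdivlMr // mul1r.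
  apply: le_trans (GI I IC iI) _; apply: block_hit_ge => //; first exact: subset_leq_card.
  exact: leq_trans (inner_le I) (leq_addr _ _).
rewrite sumr_const -[#|_|]cardsT -powersetT card_powerset cardsT card_ord.
by rewrite -[leLHS]mulr_natl mulrA.
Qed.

(** Without caps the relevant monomials are only known to be at least 1, so the gain must come from
    longer windows, of length about [G * f n]. *)
Lemma star_capless (eps : F) : l2 = 0%N -> 0 < eps ->
  exists K N0, 0 < K /\ forall n t, (N0 <= n)%N -> K * f n <= t%:R ->
  Pr F (fun u : {ffun 'I_t -> rsets n r} =>
    ~~ has_copy E (process_edges star (sample u))) <= eps.
Proof.
move=> l20 e0.
pose G := Num.max 1 (4%:R * ((2 ^ k)%:R * cst) / eps).
have G1 : 1 <= G by rewrite le_max lexx.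
have Ge : 4%:R * ((2 ^ k)%:R * cst / G) <= eps.
  rewrite mulrA ler_pdivrMr ?(lt_le_trans ltr01) // -ler_pdivrMl // mulrC.
  by rewrite le_max lexx orbT.
(* Once [y n <= d], windows of length at most [(G + 1) * f n] have length at most the number of
   [r]-sets, as [hitp_ge] requires. *)
pose d := ((G + 1) * bin_cst F r)^-1.
have d0 : 0 < d by rewrite /d invr_gt0 mulr_gt0 ?bin_cst_gt0 //; lra.
have [N1 N1d] : exists N1 : nat, d^-1 ^+ m <= N1%:R.
  by exists (Num.truncn (d^-1 ^+ m)).+1; rewrite ltW // truncnS_gt.
exists (l1%:R * (G + 1)), (maxn N1 (maxn (2 * r) k)); split.
  by rewrite mulr_gt0 ?ltr0n ?(ltnW l1_gt1) // addr_gt0 // (lt_le_trans ltr01).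
move=> n t; rewrite !geq_max => /andP[nN1 /andP[rn kn]] Kt.
have n0 : (0 < n)%N by apply: leq_trans kn.
have [w /andP[wlo whi]] := round_rate n0 G1.
have G0 : 0 <= G by lra.
have wN : (w <= #|{: rsets n r}|)%N.
  apply: (@window_le_card F r n (y n) rn (y_gt0 n0) (G + 1)); [|lra|exact: whi].
  have : y n <= d.
    apply: (@scale_small F m v n (y n) m_gt0 n0 (y_gt0 n0) (yE n0)) => //.
    by rewrite (le_trans N1d) // ler_nat.
  by rewrite mulrC /d -ler_pdivlMr ?mul1r // mulr_gt0 ?bin_cst_gt0 //; lra.
have qlo := hitp_rate_ge rn (y_gt0 n0) G0 wlo wN.
have q0 : 0 < q n w.
  by apply: lt_le_trans qlo; rewrite !mulr_gt0 ?invr_gt0 ?ltr0n ?y_gt0 //; lra.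
have /card_gt0P[x0 _] := rsets_card_gt0 rn.
have b0 : (0 < n %/ k)%N by rewrite divn_gt0.
apply: le_trans (Pr_no_copy_capless phase_length r_gt0 rs cC ray_sub card_ray card_cap
  card_tmpl tmpl_cap tmpl_sub edgesE (ltnW rv) (@block_disj _ C _ b0) _ _ b0 x0 l20 _ q0) _.
- by move=> x xC; rewrite card_block // xC.
- by move=> x; rewrite inE card_block // => /negbTE ->.
- have f1 := rate_ge1 n0.
  rewrite -(ler_nat F) natrM; apply: le_trans Kt; rewrite -mulrA ler_wpM2l ?ler0n //.
apply: le_trans Ge; rewrite ler_wpM2l ?ler0n //.
apply: (@variance_sum_le _ G) => // [||I IC iI]; [lra|lra|].
(* Each [I] contains at least one ray, so the window factor [G] enters at least once. *)
rewrite -[leLHS]mulr1 ler_pM ?ler01 //; first exact: ler_eXnr.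
apply: (@scale_ge1 F m v n (y n)) => //; [exact: y_gt0|exact: yE|].
apply: leq_trans _ (exponent_variance rv l1_gt1 (inner_le I) cond (inner_gt0 iI) (subset_leq_card IC)
  (dens IC (inner_gt0 iI))).
by rewrite leq_mul2l leq_addr orbT.
Qed.

(** By [exponent_conflict] each of the at most [2 ^ k] overlap patterns contributes a bounded
    multiple of the mean number of flowers. *)
Lemma overlap_le n (z c2 : F) : (k <= n)%N -> (0 < n)%N -> 0 < z -> 1 <= c2 -> z <= c2 * y n ->
  \sum_(I : {set 'I_k} | (I \subset ~: C) && (r <= #|I|)%N)
     ((n %/ k) ^ v * (n %/ k) ^ (v - #|I|))%:R * z ^+ (2 * l1 - inner ray I)
  <= (2 ^ k)%:R * c2 ^+ l1 * (((n %/ k) ^ v)%:R * z ^+ l1).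
Proof.
move=> kn n0 z0 c1 zc; have y0 := y_gt0 n0.
set M := _%:R * z ^+ l1.
have M0 : 0 <= M by rewrite mulr_ge0 ?ler0n ?exprn_ge0 // ltW.
have c0 : 0 <= c2 by lra.
apply: le_trans (_ : \sum_(I : {set 'I_k}) c2 ^+ l1 * M <= _); last first.
  rewrite sumr_const -[#|_|]cardsT -powersetT card_powerset cardsT card_ord.
  by rewrite -[leLHS]mulr_natl mulrA.
rewrite big_mkcond; apply: ler_sum => I _; case: ifP => [/andP[IC rI]|_]; last first.
  by rewrite mulr_ge0 ?exprn_ge0.
have iI := inner_le I.
have -> : (2 * l1 - inner ray I = l1 + (l1 - inner ray I))%N by lia.
rewrite exprD natrM (_ : _ * _ = M * (((n %/ k) ^ (v - #|I|))%:R * z ^+ (l1 - inner ray I))); last first.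
  by rewrite /M; ring.
rewrite mulrC ler_wpM2r //.
apply: le_trans (_ : n%:R ^+ (v - #|I|) * (c2 * y n) ^+ (l1 - inner ray I) <= _).
  apply: ler_pM; rewrite ?ler0n ?exprn_ge0 ?(ltW z0) //.
    by rewrite natrX lerXn2r ?nnegrE ?ler0n // ler_nat leq_div.
  by rewrite lerXn2r ?nnegrE ?mulr_ge0 ?(ltW z0) ?(ltW y0).
rewrite exprMn mulrCA -[leRHS]mulr1; apply: ler_pM; rewrite ?exprn_ge0 //.
- by rewrite mulr_ge0 ?exprn_ge0 ?ler0n // ltW.
- by apply: ler_weXn2l => //; rewrite leq_subr.
apply: (@scale_le1 F m v n (y n)) => //; first exact: yE.
rewrite mulnC; exact: (exponent_conflict rv l1_gt1 iI cond rI (subset_leq_card IC) (dens IC rI)).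
Qed.

Lemma star_caps (eps : F) : (0 < l2)%N -> 0 < eps ->
  exists K N0, 0 < K /\ forall n t, (N0 <= n)%N -> K * f n <= t%:R ->
  Pr F (fun u : {ffun 'I_t -> rsets n r} =>
    ~~ has_copy E (process_edges star (sample u))) <= eps.
Proof.
move=> l20 e0.
have C0 := cst_gt0; have B0 := bin_cst_gt0 F r.
have B1 : 1 <= bin_cst F r by rewrite ler1n muln_gt0 expn_gt0 fact_gt0.
have k2 : 0 < (2 ^ k)%:R :> F by rewrite ltr0n expn_gt0.
(* [G], [L] and [K'] make the three terms of [Pr_no_copy] at most [eps / 3] each; thus 12 is 3 times
   4 and, below, 192 is 3 times 64. *)
pose G := 12%:R * ((2 ^ k)%:R * cst) / eps.
have G0 : 0 < G by apply: divr_gt0 => //; apply: mulr_gt0; rewrite ?ltr0n //; apply: mulr_gt0.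
pose c2 := 2%:R * bin_cst F r.
have c21 : 1 <= c2 by rewrite /c2; lra.
pose L := 3%:R * ((2 ^ k)%:R * c2 ^+ l1) / eps.
have c20 : 0 < c2 by lra.
have L0 : 0 < L by rewrite /L divr_gt0 ?mulr_gt0 ?exprn_gt0 // ?ltr0n.
have p20 : 0 < 2%:R ^+ l2 :> F by rewrite exprn_gt0 ?ltr0n.
pose K' := Num.max 1 (192%:R * L * (cst * 2%:R ^+ l2) / eps).
have K1 : 1 <= K' by rewrite le_max lexx.
have Ke : 192%:R * L * (cst * 2%:R ^+ l2) / eps <= K' by rewrite le_max lexx orbT.
(* [K' + 2] dominates both window rates: 2 in phase one and [K' + 1] in phase two. *)
pose d := ((K' + 2%:R) * bin_cst F r)^-1.
have d0 : 0 < d by rewrite /d invr_gt0 mulr_gt0 //; lra.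
have nat_ge (z : F) : exists N1 : nat, z <= N1%:R.
  by exists (Num.truncn z).+1; rewrite ltW // truncnS_gt.
have [N1 N1d] := nat_ge (d^-1 ^+ m).
have [N2 N2G] := nat_ge (G ^+ m).
exists (2%:R * l1%:R + l2%:R * (K' + 1)), (maxn N2 (maxn N1 (maxn (2 * r) k))); split.
  have K10 : 0 < K' + 1 by apply: addr_gt0 => //; apply: lt_le_trans K1.
  by apply: addr_gt0; apply: mulr_gt0 => //; rewrite ?ltr0n // ltnW.
move=> n t; rewrite !geq_max => /and4P[nN2 nN1 rn kn] Kt.
have n0 : (0 < n)%N by apply: leq_trans kn.
have y0 := y_gt0 n0; have f1 := rate_ge1 n0.
have [w2 /andP[wlo whi]] := round_rate n0 K1.
have K0 : 0 <= K' by lra.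
have yd : y n <= d.
  apply: (@scale_small F m v n (y n) m_gt0 n0 y0 (yE n0)) => //.
  by rewrite (le_trans N1d) // ler_nat.
have small c : 0 <= c -> c <= K' + 2%:R -> c * bin_cst F r * y n <= 1.
  move=> c0 cK; apply: le_trans (_ : (K' + 2%:R) * bin_cst F r * d <= _).
    by apply: ler_pM; rewrite ?mulr_ge0 ?ler_wpM2r //; apply: ltW.
  by rewrite divff // mulf_neq0 // gt_eqF //; lra.
have [w1lo w1hi] := phase_length_bounds n0; pose w1 := phase_length n; rewrite -/w1 in w1lo w1hi.
have wN : (w2 <= #|{: rsets n r}|)%N.
  apply: (@window_le_card F r n (y n) rn y0 (K' + 1)); [apply: small; lra|lra|exact: whi].
have w1N : (w1 <= #|{: rsets n r}|)%N.
  apply: (@window_le_card F r n (y n) rn y0 2%:R); [apply: small; lra|lra|exact: w1hi].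
have q2lo := hitp_rate_ge rn y0 K0 wlo wN.
have q1lo : 1 * y n / 2%:R <= q n w1.
  by apply: (hitp_rate_ge rn y0) => //; rewrite mul1r.
have q1hi := hitp_rate_le rn y0 (ler0n F 2) w1hi.
have q10 : 0 < q n w1 by lra.
have q20 : 0 < q n w2.
  by apply: lt_le_trans q2lo; rewrite !mulr_gt0 ?invr_gt0 ?ltr0n //; lra.
have /card_gt0P[x0 _] := rsets_card_gt0 rn.
have b0 : (0 < n %/ k)%N by rewrite divn_gt0.
have Tt : (l1 * w1 + l2 * w2 <= t)%N.
  rewrite -(ler_nat F) natrD !natrM; apply: le_trans Kt; rewrite mulrDl -!mulrA.
  rewrite mulrCA; apply: lerD; rewrite ler_wpM2l ?ler0n //.
pose M := ((n %/ k) ^ v)%:R * q n w1 ^+ l1.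
have M0 : 0 < M by rewrite /M mulr_gt0 ?exprn_gt0 // ltr0n expn_gt0 b0.
have center1 x : x \in C -> #|block C n x| = 1%N by move=> xC; rewrite card_block // xC.
have side x : x \in ~: C -> #|block C n x| = (n %/ k)%N.
  by rewrite inE card_block // => /negbTE ->.
have bound := @Pr_no_copy F k r s l1 l2 E C ray cap tmpl (block C) phase_length r_gt0 rs cC
  ray_sub card_ray card_cap card_tmpl tmpl_cap tmpl_sub edgesE (ltnW rv) n (n %/ k)%N t
  (@block_disj _ C _ b0) center1 side b0 x0 w2 Tt L M L0 l20 q10 q20 erefl.
apply: le_trans bound _.
have -> : eps = eps / 3%:R + eps / 3%:R + eps / 3%:R by field.
apply: lerD; first apply: lerD.
- apply: le_trans (_ : 4%:R * ((2 ^ k)%:R * cst / G) <= _).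
    rewrite ler_wpM2l ?ler0n //; apply: (@variance_sum_le _ 1) => // I IC iI.
    rewrite expr1n mul1r; apply: (@scale_ge F m v n (y n)) => //.
    + exact: yE.
    + exact: ltW.
    + by rewrite (le_trans N2G) // ler_nat.
    (* Now [l2 > 0] makes the inequality strict, so a large [n] suffices and phase one can keep its
       length. *)
    apply: leq_trans _ (exponent_variance rv l1_gt1 (inner_le I) cond (inner_gt0 iI) (subset_leq_card IC)
      (dens IC (inner_gt0 iI))).
    by rewrite mulnDr -addn1 leq_add2l muln_gt0 v_gt0 l20.
  rewrite le_eqVlt; apply/orP; left; apply/eqP; rewrite /G; field.
  by rewrite !gt_eqF.
- have LM0 : 0 < L * M by apply: mulr_gt0.
  rewrite ler_pdivrMr // /overlap -/w1; apply: le_trans (overlap_le kn n0 q10 c21 q1hi) _.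
  rewrite -/M [leRHS]mulrA ler_wpM2r ?(ltW M0) // /L le_eqVlt; apply/orP; left; apply/eqP; field.
  by rewrite gt_eqF.
(* The expected number of completed flowers has order at least [K'^l2 n^v y^m = K'^l2], and
   [K'^l2 >= K'] because [K' >= 1] and [l2 > 0]. *)
have low : K' <= cst * 2%:R ^+ l2 * (M * q n w2 ^+ l2).
  have h1 := @block_hit_ge n 1 (q n w1) v l1 kn n0 ltr01 (leqnn v) (leq_addr _ _) q1lo.
  have h2 : K' ^+ l2 * y n ^+ l2 <= 2%:R ^+ l2 * q n w2 ^+ l2.
    rewrite -!exprMn lerXn2r ?nnegrE ?mulr_ge0 ?ler0n ?(ltW y0) ?(ltW q20) //; lra.
  rewrite expr1n mul1r in h1.
  apply: le_trans (_ : n%:R ^+ v * y n ^+ l1 * (K' ^+ l2 * y n ^+ l2) <= _).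
    rewrite (_ : n%:R ^+ v * y n ^+ l1 * _ = K' ^+ l2 * (y n ^+ m * n%:R ^+ v)); last by rewrite exprD; ring.
    by rewrite yE // mulr1 ler_eXnr.
  apply: le_trans (ler_pM _ _ h1 h2) _; rewrite ?mulr_ge0 ?exprn_ge0 ?ler0n ?(ltW y0) //.
  by rewrite le_eqVlt; apply/orP; left; apply/eqP; rewrite /M natrX; ring.
have X0 : 0 < M * q n w2 ^+ l2 by rewrite mulr_gt0 ?exprn_gt0.
rewrite ler_pdivrMr //; have := le_trans Ke low.
rewrite ler_pdivrMr //.
have P0 : 0 < cst * 2%:R ^+ l2 by rewrite mulr_gt0.
move: (M * _) X0 => X X0; rewrite mulrAC -[leRHS]mulrA [_ * (_ * eps)]mulrC => h.
have : 192%:R * L <= X * eps by rewrite -(ler_pM2r P0); lra.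
lra.
Qed.
End Asymptotics.

(** * Lower bound *)

Lemma enum_set (T : finType) (X : {set T}) l : #|X| = l ->
  exists f : 'I_l -> T, [/\ injective f, forall i, f i \in X & forall x, x \in X -> exists i, x = f i].
Proof.
move=> <-; exists enum_val; split=> [||x xX]; [exact: enum_val_inj|exact: enum_valP|].
by exists (enum_rank_in xX x); rewrite enum_rankK_in.
Qed.

(** * Union bound over arrival times and placements *)

Section FirstMoment.
Variable F : realFieldType.
Variables (r s k m n t : nat) (E : {set {set 'I_k}}) (S : strategy).
Hypotheses (rs : (r <= s)%N) (sn : (s <= n)%N) (m_gt0 : (0 < m)%N).
Hypothesis validS : valid_strategy r s S.
Variable ed : 'I_m -> {set 'I_k}.
Hypothesis ed_inj : injective ed.
Hypothesis ed_E : forall i, ed i \in E.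
Hypothesis card_ed : forall i, #|ed i| = s.
Local Notation N := #|{: rsets n r}|.
Local Notation Pr := (@Pr F 'I_t (rsets n r)).
Local Notation Ex := (@Ex F 'I_t (rsets n r)).
Hypothesis N_gt0 : (0 < N)%N.
Implicit Types (u : {ffun 'I_t -> rsets n r}) (phi : {ffun 'I_k -> 'I_n}) (tau : {ffun 'I_m -> 'I_t}).

Definition time_order tau (i0 : 'I_m) : bool :=
  injectiveb tau && [forall i, (i != i0) ==> (tau i0 < tau i)%N].

Definition first_edge tau i0 phi u : bool := edge_at S (sample u) (tau i0) == phi @: ed i0.

(** For the later edges only the random part is constrained, since the player controls the rest. *)
Definition later_edges tau i0 phi u : bool :=
  [forall i, (i == i0) || (val (u (tau i)) \subset phi @: ed i)].

(** Distinct edges have distinct images and hence distinct arrival times, so there is a unique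
    earliest edge [i0]. *)
Lemma copy_time_order u : has_copy E (process_edges S (sample u)) ->
  exists tau i0 phi, [&& time_order tau i0, first_edge tau i0 phi u & later_edges tau i0 phi u].
Proof.
move=> /existsP[phi /andP[/injectiveP phi_inj /forall_inP copy]].
have times (i : 'I_m) : exists j : 'I_t, edge_at S (sample u) j = phi @: ed i.
  have /mem_process_edges[j] := copy _ (ed_E i); rewrite size_sample => jt ->.
  by exists (Ordinal jt).
have [f fE] := fin_all_exists times.
have f_inj : injective f.
  by move=> i i' e; apply: ed_inj; apply: (imset_inj phi_inj); rewrite -!fE e.
pose tau := finfun f; pose i0 := [arg min_(i < Ordinal m_gt0) tau i : nat].
exists tau, i0, phi; apply/and3P; split.
- apply/andP; split; first by apply/injectiveP => i i'; rewrite !ffunE => /f_inj.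
  apply/forallP => i; apply/implyP; rewrite /i0; case: arg_minnP => // j _ minj ne.
  rewrite ltn_neqAle minj // andbT !ffunE; apply: contraNneq ne => e.
  by apply/eqP/f_inj/val_inj.
- by rewrite /first_edge ffunE fE.
apply/forallP => i; apply/orP; right; rewrite ffunE -fE /edge_at.
by rewrite nth_sample subsetUl.
Qed.

Lemma take_sample (j : nat) u u' : (forall i : 'I_t, (i < j)%N -> u i = u' i) ->
  take j (sample u) = take j (sample u').
Proof.
move=> e; apply: (@eq_from_nth _ set0); rewrite !size_take_min !size_sample // => i.
rewrite leq_min => /andP[ij it].
by rewrite !nth_take // -[i]/(val (Ordinal it)) !nth_sample e.
Qed.

Lemma card_edge_at u (j : 'I_t) : (#|edge_at S (sample u) j| <= s)%N.
Proof.
rewrite /edge_at nth_sample; apply: leq_trans (leq_card_setU _ _) _.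
have cU : #|val (u j)| = r by apply/eqP/(valP (u j)).
by rewrite cU; have [_ ->] := validS sn (run_hist S [::] (take j (sample u))) cU; rewrite subnKC.
Qed.

(** Once the first edge is known, its [s] vertices have at most [s] images each, and the other
    [k - s] vertices are free. *)
Lemma card_first_edge tau i0 u :
  (#|[pred phi | first_edge tau i0 phi u]| <= s ^ s * n ^ (k - s))%N.
Proof.
pose Z := edge_at S (sample u) (tau i0).
pose P x : {set 'I_n} := if x \in ed i0 then Z else setT.
apply: (@leq_trans #|family (fun x => mem (P x))|).
  apply/subset_leq_card/subsetP => phi; rewrite inE => /eqP e.
  apply/familyP => x; rewrite /P; case: ifP => // xe.
  by rewrite /Z e imset_f.
rewrite card_family foldrE big_map big_enum /=.
rewrite (bigID (mem (ed i0))) /=; apply: leq_mul.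
  rewrite -[X in (_ <= X ^ _)%N](card_ed i0) -[X in (_ <= _ ^ X)%N](card_ed i0) -prod_nat_const.
  by apply: leq_prod => x xe; rewrite /P xe card_ed card_edge_at.
rewrite (eq_bigr (fun=> n)) => [|x /negbTE xe]; last by rewrite /P xe cardsT card_ord.
rewrite (eq_bigl (mem (~: ed i0))); last by move=> x; rewrite !inE.
by rewrite prod_nat_const cardsCs setCK card_ord card_ed.
Qed.

Lemma Pr_later_edges tau i0 phi : injective tau ->
  Pr (later_edges tau i0 phi) <= ('C(s, r)%:R / N%:R) ^+ m.-1.
Proof.
move=> tau_inj.
rewrite (@Pr_forall_window F _ _ N_gt0 _ (fun i => [set tau i])); first last.
- by move=> i u u' e; rewrite e // inE.
- by move=> i i' ne; rewrite disjoints1 inE (inj_eq tau_inj).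
rewrite (bigD1 i0) //= -[leRHS]mul1r; apply: ler_pM; rewrite ?Pr_ge0 ?Pr_le1 ?prodr_ge0 //.
  by move=> i _; apply: Pr_ge0.
have -> : (m.-1 = #|[pred i | i != i0]|)%N by rewrite -[in LHS](card_ord m) -(cardC1 i0).
rewrite -prodr_const; apply: ler_prod => i ne; rewrite Pr_ge0 //=.
have -> : Pr (fun u => (i == i0) || (val (u (tau i)) \subset phi @: ed i)) =
    Pr (fun u => [forall j in [set tau i], val (u j) \subset phi @: ed i]).
  apply: eq_Ex => u; rewrite (negbTE ne) /=; congr ((nat_of_bool _)%:R).
  by apply/idP/forall_inP => [h j|h]; [rewrite inE => /eqP ->|apply: h; rewrite inE].
rewrite (Pr_in_window F N_gt0 [set tau i] (fun U => val U \subset phi @: ed i)) cards1 expr1.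
rewrite ler_wpM2r ?invr_ge0 ?ler0n // ler_nat.
apply: (@leq_trans #|[set U : {set 'I_n} | U \subset phi @: ed i & #|U| == r]|).
  rewrite -(card_image val_inj); apply/subset_leq_card/subsetP => U /imageP[V VB ->].
  by rewrite inE (eqP (valP V)) eqxx andbT.
rewrite cards_draws; apply: leq_bin2l; rewrite -(card_ed i); exact: leq_imset_card.
Qed.

(** Summing over [phi] under the expectation replaces the probability of the first edge by the
    pointwise count of [card_first_edge], valid whatever the player does. *)
Lemma Pr_copy_le :
  Pr (fun u => has_copy E (process_edges S (sample u))) <=
  (t ^ m * m)%:R * ((s ^ s * n ^ (k - s))%:R * ('C(s, r)%:R / N%:R) ^+ m.-1).
Proof.
set p := (_ / _) ^+ _.
have p0 : 0 <= p by rewrite exprn_ge0 // divr_ge0 ?ler0n.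
pose event tau i0 phi u := first_edge tau i0 phi u && later_edges tau i0 phi u.
apply: le_trans (_ : Ex (fun u => \sum_tau \sum_(i0 | time_order tau i0) \sum_phi
    (event tau i0 phi u)%:R) <= _).
  apply: (Ex_le N_gt0) => u; case: (boolP (has_copy _ _)) => [|_]; last first.
    by do 3!apply: sumr_ge0 => ? _; apply: ler0n.
  move=> /copy_time_order[tau [i0 [phi /and3P[ord h1 h2]]]].
  rewrite (bigD1 tau) //= (bigD1 i0) //= (bigD1 phi) //= /event h1 h2 -!addrA.
  rewrite lerDl !addr_ge0 //; first by apply: sumr_ge0 => ? _; apply: ler0n.
    by do 2!apply: sumr_ge0 => ? _; apply: ler0n.
  by do 3!apply: sumr_ge0 => ? _; apply: ler0n.
have bound tau i0 : time_order tau i0 ->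
    \sum_phi Pr (event tau i0 phi) <= (s ^ s * n ^ (k - s))%:R * p.
  move=> /andP[/injectiveP tau_inj /forallP later].
  apply: le_trans (_ : \sum_phi Pr (first_edge tau i0 phi) * p <= _).
    apply: ler_sum => phi _.
    (* The first edge is determined by times up to [tau i0], the constraints on the later edges by
       strictly larger times. *)
    pose W := [set j : 'I_t | (j <= tau i0)%N].
    apply: le_trans (_ : Pr (first_edge tau i0 phi) * Pr (later_edges tau i0 phi) <= _);
      last by rewrite ler_wpM2l ?Pr_ge0 ?Pr_later_edges.
    rewrite -(@Ex_indep _ _ _ N_gt0 W) => [|u u' e|u u' e].
    - by apply: (Ex_le N_gt0) => u; rewrite /event -natrM mulnb.
    - rewrite /first_edge (@eq_edge_at _ S (sample u) (sample u')) //.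
      by apply: take_sample => i; rewrite ltnS => h; apply: e; rewrite inE.
    rewrite /later_edges; congr ((nat_of_bool _)%:R); apply: eq_forallb => i.
    case: eqP => //= /eqP ne; rewrite e // !inE -ltnNge.
    by have := later i; rewrite ne.
  rewrite -mulr_suml ler_wpM2r // -Ex_sum -[leRHS](Ex_cst 'I_t N_gt0); apply: (Ex_le N_gt0) => u.
  rewrite -natr_sum ler_nat; apply: leq_trans (card_first_edge tau i0 u).
  rewrite -sum1_card [leqRHS]big_mkcond; apply: leq_sum => phi _.
  by rewrite inE; case: (first_edge _ _ _ _).
rewrite Ex_sum; apply: le_trans (_ : \sum_(tau : {ffun 'I_m -> 'I_t}) \sum_(i0 : 'I_m) 
    (s ^ s * n ^ (k - s))%:R * p <= _).
  apply: ler_sum => tau _; rewrite Ex_sum big_mkcond; apply: ler_sum => i0 _.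
  case: ifP => [ord|_]; last by rewrite mulr_ge0 ?ler0n.
  by rewrite Ex_sum; apply: bound.
by rewrite !sumr_const card_ffun !card_ord -mulrnA -[leLHS]mulr_natl mulnC.
Qed.
End FirstMoment.

(** * The threshold *)

(** Tuples all of whose entries are [r]-sets correspond bijectively to functions into
    [rsets n r]. *)
Lemma prob_copyE r k (E : {set {set 'I_k}}) S n t :
  prob_copy r E S n t =
  Pr R (fun u : {ffun 'I_t -> rsets n r} => has_copy E (process_edges S (sample u))).
Proof.
pose tup (u : {ffun 'I_t -> rsets n r}) : t.-tuple {set 'I_n} := [tuple val (u i) | i < t].
have tupE u : tval (tup u) = sample u by [].
have tup_inj : injective tup.
  move=> u u' e; apply/ffunP => i; apply: val_inj.
  by have := congr1 (fun w => tnth w i) e; rewrite !tnth_mktuple.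
have count (P : pred (seq {set 'I_n})) :
    #|[pred us : t.-tuple {set 'I_n} | all (fun U : {set 'I_n} => #|U| == r) us && P us]|
    = #|[pred u : {ffun 'I_t -> rsets n r} | P (sample u)]|.
  rewrite -[RHS](card_image tup_inj).
  apply: eq_card => us; rewrite inE.
  apply/andP/imageP => [[/allP rus Pus]|[u Pu ->]]; last first.
    split=> //; apply/allP => U; rewrite tupE => /mapP[i _ ->]; exact: (valP (u i)).
  have rU i : #|tnth us i| == r by apply/rus/mem_tnth.
  pose u : {ffun 'I_t -> rsets n r} := [ffun i => exist _ (tnth us i) (rU i)].
  have e : tup u = us by apply: eq_from_tnth => i; rewrite tnth_mktuple ffunE.
  by exists u => //; rewrite inE -tupE e.
have all_rsets : #|[pred us : t.-tuple {set 'I_n} | all (fun U : {set 'I_n} => #|U| == r) us]|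
    = (#|{: rsets n r}| ^ #|'I_t|)%N.
  rewrite -card_ffun -[RHS](count predT).
  by apply: eq_card => us; rewrite !inE andbT.
rewrite /prob_copy RdivE !INRE Pr_card; congr (_%:R / _%:R); last exact: all_rsets.
exact: (count (fun us => has_copy E (process_edges S us))).
Qed.

Lemma card_proper_union (T : finType) (I A B : {set T}) r :
  A \subset I -> B \subset I -> #|A| = r -> #|B| = r -> A != B -> (r < #|I|)%N.
Proof.
move=> AI BI cA cB; apply: contraNltn => le.
have eA : A = I by apply/eqP; rewrite eqEcard AI cA.
by rewrite eA eq_sym eqEcard BI cB.
Qed.

(** Turns the starplus into indexed rays, cap edges and templates, and edge-balancedness into a
    division-free inequality on the rays inside [I]. *)
Lemma star_data r s k l1 l2 (E : {set {set 'I_k}}) (C : {set 'I_k}) :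
  (0 < r)%N -> (r < s)%N -> (s < k)%N -> is_starplus s (s - r) l1 l2 E C ->
  (1 < l1)%N -> edge_balanced r (~: C) (flower_edges E C) ->
  exists (ray : 'I_l1 -> {set 'I_k}) (cap tmpl : nat -> {set 'I_k}),
  [/\ [/\ forall j, ray j \subset ~: C, forall j, #|ray j| = r &
        forall I : {set 'I_k}, I \subset ~: C -> (r <= #|I|)%N ->
          (inner ray I * (#|~: C| - r) <= (l1 - 1) * (#|I| - r) + (#|~: C| - r))%N],
      [/\ forall j, (j < l2)%N -> #|cap j| = s, forall j, (j < l2)%N -> #|tmpl j| = r,
        forall j, (j < l2)%N -> tmpl j \subset cap j &
        forall j, (j < l2)%N -> tmpl j \subset ~: C] &
      forall e, e \in E ->
        (exists j, e = C :|: ray j) \/ (exists2 j, (j < l2)%N & e = cap j)].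
Proof.
move=> r0 rs sk [cE [_ cC] cR _ cK] l1_gt1 bal.
have [R0 [R0_inj R0R R0surj]] := enum_set cR.
have [K0 [_ K0K K0surj]] := enum_set cK.
have RE j : R0 j \in E /\ C \subset R0 j by have := R0R j; rewrite inE => /andP[].
pose ray j := R0 j :\: C.
have ray_sub j : ray j \subset ~: C by rewrite /ray setDE subsetIr.
have CU j : C :|: ray j = R0 j.
  rewrite /ray setDE setUIr setUCr setIT; apply/setUidPr; by case: (RE j).
have card_ray j : #|ray j| = r.
  have [jE CR] := RE j; rewrite /ray cardsD (setIidPr CR) cC cE //; lia.
have ray_inj : injective ray by move=> j j' e; apply: R0_inj; rewrite -!CU e.
pose cap j := if insub j is Some i then K0 i else set0.
have capE j : (j < l2)%N -> cap j \in E /\ ~~ (C \subset cap j).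
  by move=> jl; rewrite /cap insubT /=; have := K0K (Sub j jl); rewrite inE => /andP[].
have card_cap j : (j < l2)%N -> #|cap j| = s by move=> /capE[/cE].
(* A template exists because a cap edge has [s] vertices, at most [s - r] of them central. *)
pose tm j := odflt set0 [pick X : {set 'I_k} | (X \subset cap j :\: C) && (#|X| == r)].
have tmE j : (j < l2)%N -> tm j \subset cap j :\: C /\ #|tm j| = r.
  move=> jl; rewrite /tm; case: pickP => [X /andP[XK /eqP] //|none].
  have : (r <= #|cap j :\: C|)%N.
    rewrite cardsD card_cap //; have := subset_leq_card (subsetIr (cap j) C); lia.
  move=> le; have : (0 < #|[set X : {set 'I_k} | X \subset cap j :\: C & #|X| == r]|)%N.
    by rewrite cards_draws bin_gt0.
  by rewrite card_gt0 => /set0Pn[X]; rewrite inE none.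
exists ray, cap, tm; split.
- split=> // I IC rI.
  have flowE : flower_edges E C = [set ray j | j : 'I_l1].
    apply/setP => e; apply/imsetP/imsetP => -[e0].
      rewrite inE => e0R ->; have [|j ej] := R0surj e0; first by rewrite inE.
      by exists j => //; rewrite /ray -ej.
    by move=> _ ->; exists (R0 e0) => //; rewrite inE; case: (RE e0) => -> ->.
  have card_flow : #|flower_edges E C| = l1 by rewrite flowE card_imset // card_ord.
  pose F' := [set ray j | j in [set j | ray j \subset I]].
  have cF' : #|F'| = inner ray I by rewrite card_imset.
  have cV : #|~: C| = (k - (s - r))%N by rewrite cardsCs setCK card_ord cC.
  case: (leqP (inner ray I) 1) => [le1|gt1].
    apply: leq_trans (leq_addl _ _); rewrite -[leqRHS]mul1n leq_mul2r le1 orbT //.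
  (* Two distinct rays inside [I] force more than [r] vertices, so the denominator in [gdens] is
     positive. *)
  have rltI : (r < #|I|)%N.
    move: gt1; rewrite /inner => /card_gt1P[j [j' [+ +]]]; rewrite !inE => jI j'I ne.
    apply: (card_proper_union jI j'I) => //.
    by rewrite (inj_eq ray_inj).
  have := bal I F' IC _ _ _; rewrite cF' card_flow /gdens.
  rewrite (_ : (inner ray I == 1)%N = false); last by apply/negbTE; rewrite gtn_eqF.
  rewrite (_ : (l1 == 1)%N = false); last by apply/negbTE; rewrite gtn_eqF.
  move=> H; have {H} : ((inner ray I - 1)%:R / (#|I| - r)%:R <= (l1 - 1)%:R / (#|~: C| - r)%:R :> R)%R.
    have rv : (r <= #|~: C|)%N by rewrite cV; lia.
    rewrite (natrB _ (ltnW rltI)) (natrB _ rv).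
    rewrite -!INRE; apply/RleP; apply: H.
    + by rewrite flowE; apply: imsetS; apply/subsetP.
    + by move=> f /imsetP[j]; rewrite inE => ? ->.
    + lia.
  have d0 : (0 < #|~: C| - r)%N by rewrite cV; lia.
  rewrite ler_pdivrMr ?ltr0n ?subn_gt0 // mulrAC ler_pdivlMr ?ltr0n // -!natrM ler_nat.
  move: d0 gt1; move: (inner ray I) (#|~: C| - r)%N (#|I| - r)%N => e d j; nia.
- split=> // j jl; try by case: (tmE j jl).
    by have [+ _] := tmE j jl; move=> /subset_trans; apply; rewrite subsetDl.
  by have [+ _] := tmE j jl; move=> /subset_trans; apply; rewrite setDE subsetIr.
move=> e eE; case: (boolP (C \subset e)) => Ce.
  by left; have [|j ->] := R0surj e; [rewrite inE eE|exists j; rewrite CU].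
have [|j ->] := K0surj e; first by rewrite inE eE.
right; exists j; first exact: ltn_ord.
by rewrite /cap valK.
Qed.

Lemma Rpower_scale (n m v r : nat) (a : R) : (0 < n)%N -> (0 < m)%N -> a = v%:R / m%:R ->
  let y := Rpower n%:R (- a) in
  [/\ 0 < y, y ^+ m * n%:R ^+ v = 1 & Rpower n%:R (r%:R - a) = n%:R ^+ r * y].
Proof.
move=> n0 m0 ea y.
have np : Rlt 0 (n%:R : R) by apply/RltP; rewrite ltr0n.
have powE z j : Rlt 0 z -> z ^+ j = Rpower z j%:R :> R.
  by move=> z0; rewrite -RpowE -INRE Rpower_pow.
have y0 : Rlt 0 y by apply: exp_pos.
split; first exact/RltP.
  rewrite (powE y) // (powE n%:R) // /y Rpower_mult -RmultE -Rpower_plus.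
  rewrite (_ : Rplus _ _ = 0) ?Rpower_O //.
  by rewrite RplusE RmultE ea mulNr divfK ?addNr // pnatr_eq0 -lt0n.
by rewrite (powE n%:R) // /y -RmultE -Rpower_plus.
Qed.

(** The powers of [n] and [y] combine to [n^v y^m = 1]; since [d <= 1], the factor [d^m] is at most
    [d]. *)
Lemma first_moment_bound (F : realFieldType) (r s k m v n t : nat) (y d : F) :
  (0 < m)%N -> (v = k - s + r)%N -> (2 * r <= n)%N -> (0 < n)%N -> 0 < y ->
  y ^+ m * n%:R ^+ v = 1 -> 0 <= d -> d <= 1 -> t%:R <= d * (n%:R ^+ r * y) ->
  (t ^ m * m)%:R * ((s ^ s * n ^ (k - s))%:R * ('C(s, r)%:R / #|{: rsets n r}|%:R) ^+ m.-1)
  <= d * ((m * s ^ s)%:R * ('C(s, r)%:R * bin_cst F r) ^+ m.-1).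
Proof.
move=> m0 ev rn n0 y0 yE d0 d1 td.
have N0 : 0 < #|{: rsets n r}|%:R :> F by rewrite ltr0n (rsets_card_gt0 rn).
have nr0 : 0 < n%:R ^+ r :> F by rewrite exprn_gt0 ?ltr0n.
have B0 := bin_cst_gt0 F r.
have tm : t%:R ^+ m <= d * (n%:R ^+ r * y) ^+ m.
  apply: le_trans (_ : (d * (n%:R ^+ r * y)) ^+ m <= _).
    by rewrite lerXn2r ?nnegrE ?ler0n ?mulr_ge0 // ltW.
  rewrite exprMn ler_wpM2r ?exprn_ge0 ?mulr_ge0 ?(ltW y0) ?(ltW nr0) //.
  by rewrite -[leRHS]expr1 ler_wiXn2l.
have cn : 'C(s, r)%:R / #|{: rsets n r}|%:R <= 'C(s, r)%:R * bin_cst F r / n%:R ^+ r.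
  rewrite -mulrA ler_wpM2l ?ler0n // ler_pdivlMr // mulrC ler_pdivrMr //.
  exact: rsets_card_ge.
apply: le_trans (_ : d * (n%:R ^+ r * y) ^+ m * m%:R * ((s ^ s * n ^ (k - s))%:R *
   ('C(s, r)%:R * bin_cst F r / n%:R ^+ r) ^+ m.-1) <= _).
  apply: ler_pM; rewrite ?ler0n //.
  - by rewrite mulr_ge0 ?exprn_ge0 ?divr_ge0 ?ler0n.
  - by rewrite natrM natrX ler_wpM2r.
  rewrite ler_wpM2l ?ler0n // lerXn2r ?nnegrE ?divr_ge0 ?mulr_ge0 ?ler0n ?(ltW nr0) ?(ltW B0) //.
rewrite le_eqVlt; apply/orP; left; apply/eqP.
have em : (n%:R ^+ r * y) ^+ m = n%:R ^+ r * (n%:R ^+ r) ^+ m.-1 * y ^+ m.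
  by rewrite exprMn -exprS prednK.
have e1 : n%:R ^+ (k - s) * n%:R ^+ r * y ^+ m = 1 :> F by rewrite -exprD -ev mulrC.
rewrite em expr_div_n !natrM !natrX.
have z0 : (n%:R ^+ r) ^+ m.-1 != 0 :> F by rewrite expf_neq0 ?gt_eqF.
move: z0 e1; move: ((n%:R ^+ r) ^+ m.-1) (y ^+ m) => z ym z0 e1.
transitivity (d * (m%:R * s%:R ^+ s * ('C(s, r)%:R * bin_cst F r) ^+ m.-1) *
  (n%:R ^+ (k - s) * n%:R ^+ r * ym)); last by rewrite e1 mulr1.
by field.
Qed.

Section Threshold.
Variables (r s k l1 l2 : nat) (E : {set {set 'I_k}}) (C : {set 'I_k}).
Hypotheses (r_gt0 : (0 < r)%N) (rs : (r < s)%N) (sk : (s < k)%N) (l1_gt1 : (1 < l1)%N).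
Hypothesis starE : is_starplus s (s - r) l1 l2 E C.
Local Notation v := (k - s + r)%N.
Local Notation m := (l1 + l2)%N.
Definition exponent : R := v%:R / m%:R.
Definition scale (n : nat) : R := Rpower n%:R (- exponent).

Let m_gt0 : (0 < m)%N. Proof. by lia. Qed.

Lemma scale_gt0 n : (0 < n)%N -> 0 < scale n.
Proof. by move=> n0; have [] := Rpower_scale r n0 m_gt0 (erefl exponent). Qed.

Lemma scaleE n : (0 < n)%N -> scale n ^+ m * n%:R ^+ v = 1.
Proof. by move=> n0; have [] := Rpower_scale r n0 m_gt0 (erefl exponent). Qed.

Lemma threshold_scale n : (0 < n)%N -> Rpower (INR n) (r%:R - exponent) = n%:R ^+ r * scale n.
Proof. by rewrite INRE => n0; have [] := Rpower_scale r n0 m_gt0 (erefl exponent). Qed.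

Lemma card_setC_center : #|~: C| = v.
Proof. by case: starE => _ [_ cC] _ _ _; rewrite cardsCs setCK card_ord cC; lia. Qed.

Lemma little_o_le (f g : nat -> R) (d : R) : little_o f g -> 0 < d ->
  exists N, forall n, (N <= n)%N -> `|f n| <= d * `|g n|.
Proof.
move=> fg d0; have [N NE] := fg d (RltP d0); exists N => n Nn.
by rewrite -!RabsE -RmultE; apply/RleP/NE.
Qed.

Lemma starplus_tau_le : (m * (k - s) <= v * (l1 - 1))%N ->
  edge_balanced r (~: C) (flower_edges E C) ->
  tau_le r s E (fun n => Rpower (INR n) (r%:R - exponent)).
Proof.
move=> cond bal; have cV := card_setC_center.
have [ray [cap [tmpl [[ray_sub card_ray dens] [card_cap card_tmpl tmpl_cap tmpl_sub] edgesE]]]] :=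
  star_data r_gt0 rs sk starE l1_gt1 bal.
have cC : #|C| = (s - r)%N by case: starE => _ [].
have rv : (r < #|~: C|)%N by rewrite cV; lia.
have cond' : (m * (#|~: C| - r) <= #|~: C| * (l1 - 1))%N by rewrite cV addnK.
have yE n : (0 < n)%N -> scale n ^+ m * n%:R ^+ #|~: C| = 1 by rewrite cV; apply: scaleE.
exists (star_strategy r s l2 C ray cap tmpl (block C) (phase_length r scale)); split.
  by apply: target_strategy_valid; apply: ltnW.
move=> t small eps eps0.
have e20 : 0 < eps / 2%:R by rewrite divr_gt0 //; apply/RltP.
have [K [N0 [K0 bound]]] : exists K N0, 0 < K /\ forall n t, (N0 <= n)%N ->
    K * (n%:R ^+ r * scale n) <= t%:R ->
    Pr R (fun u : {ffun 'I_t -> rsets n r} => ~~ has_copy E (process_edges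
      (star_strategy r s l2 C ray cap tmpl (block C) (phase_length r scale)) (sample u))) <= eps / 2%:R.
  have [l20|l20] := posnP l2.
    exact: (star_capless r_gt0 rs cC ray_sub card_ray card_cap card_tmpl tmpl_cap tmpl_sub edgesE
      rv l1_gt1 cond' dens scale_gt0 yE l20 e20).
  exact: (star_caps r_gt0 rs cC ray_sub card_ray card_cap card_tmpl tmpl_cap tmpl_sub edgesE
    rv l1_gt1 cond' dens scale_gt0 yE l20 e20).
(* Instantiating [little_o] with [1 / K] makes [t n] at least [K] times the threshold for all large
   [n]. *)
have Ki : 0 < K^-1 by rewrite invr_gt0.
have [N1 N1E] := little_o_le small Ki.
exists (maxn N0 (maxn N1 (2 * r)%N)) => n; rewrite !geq_max => /and3P[nN0 nN1 rn].
have n0 : (0 < n)%N by apply: leq_trans rn; rewrite muln_gt0.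
have f0 : 0 <= n%:R ^+ r * scale n by rewrite mulr_ge0 ?exprn_ge0 ?ler0n // ltW ?scale_gt0.
have Kt : K * (n%:R ^+ r * scale n) <= (t n)%:R.
  have := N1E n nN1; rewrite threshold_scale // INRE normr_nat ger0_norm //.
  by rewrite ler_pdivlMl.
apply/RltP; rewrite RabsE RminusE prob_copyE.
set A := fun u => has_copy _ _.
have -> : Pr R A = 1 - Pr R (fun u => ~~ A u) by rewrite PrC ?(rsets_card_gt0 rn) //; ring.
rewrite addrAC subrr add0r normrN ger0_norm ?Pr_ge0 ?(rsets_card_gt0 rn) //.
apply: le_lt_trans (bound n (t n) nN0 Kt) _.
by rewrite ltr_pdivrMr // ltr_pMr ?ltr1n //; apply/RltP.
Qed.

Lemma starplus_tau_ge : tau_ge r s E (fun n => Rpower (INR n) (r%:R - exponent)).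
Proof.
case: starE => cE _ cR _ cK S validS t small eps eps0.
have cEm : #|E| = m.
  rewrite -cR -cK -(cardsID [set e : {set 'I_k} | C \subset e] E).
  by congr (_ + _)%N; apply: eq_card => e; rewrite !inE // andbC.
have [ed [ed_inj edE _]] := enum_set cEm.
pose c5 : R := (m * s ^ s)%:R * ('C(s, r)%:R * bin_cst R r) ^+ m.-1.
have c50 : 0 < c5.
  apply: mulr_gt0; first by rewrite ltr0n muln_gt0 m_gt0 expn_gt0; lia.
  by rewrite exprn_gt0 // mulr_gt0 ?bin_cst_gt0 // ltr0n bin_gt0 ltnW.
have e0 : 0 < eps by apply/RltP.
pose d := Num.min 1 (eps / 2%:R / c5).
have d0 : 0 < d by rewrite lt_min ltr01 !divr_gt0.
have d1 : d <= 1 by rewrite ge_min lexx.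
have dc : d * c5 <= eps / 2%:R by rewrite -ler_pdivlMr // ge_min lexx orbT.
have [N1 N1E] := little_o_le small d0.
exists (maxn s (maxn N1 (2 * r)%N)) => n; rewrite !geq_max => /and3P[sn nN1 rn].
have n0 : (0 < n)%N by apply: leq_trans rn; rewrite muln_gt0.
have f0 : 0 <= n%:R ^+ r * scale n by rewrite mulr_ge0 ?exprn_ge0 ?ler0n // ltW ?scale_gt0.
have td : (t n)%:R <= d * (n%:R ^+ r * scale n).
  by have := N1E n nN1; rewrite threshold_scale // INRE normr_nat (ger0_norm f0).
apply/RltP; rewrite RabsE !RminusE prob_copyE addrAC subrr add0r normrN.
rewrite ger0_norm ?Pr_ge0 ?(rsets_card_gt0 rn) //.
apply: le_lt_trans (Pr_copy_le R (t n) (ltnW rs) sn m_gt0 validS ed_inj edE _ (rsets_card_gt0 rn)) _.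
  by move=> i; apply: cE.
apply: le_lt_trans (first_moment_bound m_gt0 erefl rn n0 (scale_gt0 n0) (scaleE n0) (ltW d0) d1 td) _.
by apply: le_lt_trans dc _; rewrite ltr_pdivrMr // ltr_pMr ?ltr1n.
Qed.

Lemma starplus_tau_eq :
  Rle (Rdiv (INR m) (INR (l1 - 1))) (Rdiv (Rplus (Rminus (INR k) (INR s)) (INR r)) (Rminus (INR k) (INR s))) ->
  edge_balanced r (~: C) (flower_edges E C) ->
  tau_eq r s E (fun n => Rpower (INR n)
    (Rminus (INR r) (Rdiv (Rplus (Rminus (INR k) (INR s)) (INR r)) (INR m)))).
Proof.
have ev : Rplus (Rminus (INR k) (INR s)) (INR r) = v%:R.
  by rewrite RplusE RminusE !INRE -natrB 1?ltnW // -natrD.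
have ed : Rminus (INR k) (INR s) = (k - s)%:R by rewrite RminusE !INRE -natrB // ltnW.
rewrite ev ed !RdivE RminusE !INRE => /RleP cond bal.
have {}cond : (m * (k - s) <= v * (l1 - 1))%N.
  by move: cond; rewrite ler_pdivrMr ?ltr0n ?subn_gt0 // mulrAC ler_pdivlMr ?ltr0n ?subn_gt0 // -!natrM ler_nat.
by split; [apply: starplus_tau_le | apply: starplus_tau_ge].
Qed.
End Threshold.

(* Makes [%R] denote [R_scope] again in the statement below. *)
Local Close Scope ring_scope.
Require Import Defs.
From mathcomp Require Import all_boot.
From Stdlib Require Import Reals.

Theorem theorem4 (r s k l1 l2 : nat) (E : {set {set 'I_k}}) (C : {set 'I_k}) :
  (2 <= r)%N -> (r < s)%N -> (s < k)%N ->
  is_starplus s (s - r) l1 l2 E C -> (2 <= l1)%N ->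
  (INR (l1 + l2) / INR (l1 - 1) <= (INR k - INR s + INR r) / (INR k - INR s))%R ->
  edge_balanced r (~: C) (flower_edges E C) ->
  tau_eq r s E
    (fun n : nat => Rpower (INR n) (INR r - (INR k - INR s + INR r) / INR (l1 + l2)))%R.
Proof.
move=> r2 rs sk starE l12 cond bal.
exact: starplus_tau_eq (ltnW r2) rs sk l12 starE cond bal.
Qed.
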